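(* Let $p$ be a prime, and let $A\hookrightarrow\mathcal{B}_{\le1}(\mathbb{Q}_p(X))$ and $B\hookrightarrow\mathcal{B}_{\le1}(\mathbb{Q}_p(Y))$ be two $p$-adic operator algebras (with the given isometric $*$-embeddings) whose norms are the canonical $p$-adic norms. Suppose that the norm on the algebraic tensor product $A\otimes_{\mathrm{alg}}B$ (over $\mathbb{Z}_p$) induced from $A\otimes_{\mathrm{alg}}B\subseteq\mathcal{B}_{\le1}(\mathbb{Q}_p(X)\otimes\mathbb{Q}_p(Y))$ is the canonical $p$-adic norm of $A\otimes_{\mathrm{alg}}B$. Then $$A\otimes_{\max}B\;\cong\;A\otimes_\pi B\;\cong\;A\otimes_{\min}B,$$ where the isomorphisms are isometric $*$-isomorphisms and $\otimes_{\max}$, $\otimes_\pi$, $\otimes_{\min}$ denote the maximal, the completed projective, and the spatial tensor product.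
   Context: $|\cdot|_p$ is the $p$-adic absolute value. For a nonempty set $X$, $\mathbb{Q}_p(X)$ is the $\mathbb{Z}_p$-module of all functions $\xi\colon X\to\mathbb{Q}_p$ with $\xi(x)\in\mathbb{Z}_p$ for all but finitely many $x\in X$. It carries the norm $\|\xi\|_\infty=\sup_{x}|\xi(x)|_p$ and the topology $\tau$: a set $U$ is $\tau$-open iff for every finite $P\subseteq X$ the set $U\cap U_P$ is open in the product topology of $U_P=\prod_{x\in P}\mathbb{Q}_p\times\prod_{x\notin P}\mathbb{Z}_p$. The pairing $\langle\xi,\eta\rangle=\sum_{x\in X}(\xi(x)\eta(x)+\mathbb{Z}_p)\in\mathbb{Q}_p/\mathbb{Z}_p$ is well defined. $\mathcal{B}_{\le 1}(\mathbb{Q}_p(X))$ is the $\mathbb{Z}_p$-algebra of all $\mathbb{Z}_p$-linear $\tau$-continuous maps $T$ on $\mathbb{Q}_p(X)$ with operator norm $\|T\|=\sup_{\|\xi\|_\infty\le1}\|T\xi\|_\infty\le 1$, with the involution $T\mapsto T^*$ determined by $\langle T\xi,\eta\rangle=\langle\xi,T^*\eta\rangle$. A $p$-adic operator algebra is a Banach $\mathbb{Z}_p$-algebra (complete nonarchimedean norm with $\|\lambda a\|=|\lambda|_p\|a\|$ and $\|ab\|\le\|a\|\|b\|$, not necessarily unital) with a $\mathbb{Z}_p$-linear involution, isometrically $*$-isomorphic to a closed $*$-subalgebra of some $\mathcal{B}_{\le1}(\mathbb{Q}_p(X))$. The canonical $p$-adic norm on a $p$-torsionfree, $p$-adically separated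 $\mathbb{Z}_p$-module $M$ is $\|x\|_p=p^{-\nu_p(x)}$, $\nu_p(x)=\sup\{n\in\mathbb{N}:x\in p^nM\}$. For a $*$-algebra $C$ over $\mathbb{Z}_p$, the enveloping $p$-adic operator algebra $C^u$ is the Hausdorff completion of $C$ for the seminorm $\|c\|_u=\sup\|\sigma(c)\|$ over all $*$-homomorphisms $\sigma\colon C\to\mathcal{B}_{\le1}(\mathbb{Q}_p(Z))$, $Z$ any set. The algebraic tensor product has $(a\otimes b)(a'\otimes b')=aa'\otimes bb'$, $(a\otimes b)^*=a^*\otimes b^*$. Maximal tensor product: $A\otimes_{\max}B=(A\otimes_{\mathrm{alg}}B)^u$. Completed projective tensor product $A\otimes_\pi B$: completion of $A\otimes_{\mathrm{alg}}B$ for the norm $\|u\|=\inf\{\max_i\|a_i\|\|b_i\|: u=\sum_{i=1}^r a_i\otimes b_i\}$. Spatial tensor product: put $\mathbb{Q}_p(X)\otimes\mathbb{Q}_p(Y):=\mathbb{Q}_p(X\times Y)$ and $(\xi\otimes\eta)(x,y)=\xi(x)\eta(y)$. With $\delta_x$ the indicator function of $x$, for $U\in\mathcal{B}_{\le1}(\mathbb{Q}_p(X))$, $V\in\mathcal{B}_{\le1}(\mathbb{Q}_p(Y))$ let $U\otimes V\in\mathcal{B}_{\le1}(\mathbb{Q}_p(X\times Y))$ be the operator with $(U\otimes V)(\delta_x\otimes\delta_y)=U(\delta_x)\otimes V(\delta_y)$. Then $A\otimes_{\min}B$ is the norm closure in $\mathcal{B}_{\le1}(\mathbb{Q}_p(X\times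 Y))$ of the $\mathbb{Z}_p$-algebra generated by all $a\otimes b$, $a\in A$, $b\in B$ (using the given embeddings). *)

(* Defs.v *)
From HB Require Import structures.
From mathcomp Require Import all_boot all_order all_algebra cyclic.
From mathcomp Require Import all_classical all_reals ereal topology normedtype sequences exp.

Set Implicit Arguments.
Unset Strict Implicit.
Unset Printing Implicit Defensive.

Import Order.TTheory GRing.Theory Num.Theory numFieldNormedType.Exports.
Local Open Scope classical_set_scope.
Local Open Scope ring_scope.

(* Z_p is the inverse limit of the rings Z/p^n; a compatible family of residue
   classes is stored as the sequence x of its remainders 0 <= x n < p ^ n. *)
Section PadicIntegers.
Variable p : nat.

Definition compatible (x : nat -> nat) :=
  forall m n, (m <= n)%N -> (x n %% p ^ m)%N = x m.

Record padic_seq := PadicSeq {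
  residue :> nat -> nat;
  _ : `[< compatible residue >] }.

HB.instance Definition _ := [isSub for residue].
HB.instance Definition _ := [Choice of padic_seq by <:].

Lemma residueP (x : padic_seq) : compatible x.
Proof. by case: x => x /= /asboolP. Qed.

Lemma residue_mod (x : padic_seq) n : (x n %% p ^ n)%N = x n.
Proof. exact: residueP. Qed.

Lemma padic_seqP (x y : padic_seq) : (forall n, x n = y n) -> x = y.
Proof. by move=> xy; apply/val_inj/funext => n; exact: xy. Qed.

Definition padic_mk (f : nat -> nat) (hf : compatible f) : padic_seq :=
  PadicSeq (introT (asboolP _) hf).

Fact add_compatible (x y : padic_seq) :
  compatible (fun n => (x n + y n) %% p ^ n)%N.
Proof.
move=> m n mn; rewrite modn_dvdm ?dvdn_exp2l//.
by rewrite -modnDm !residueP.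
Qed.

Fact mul_compatible (x y : padic_seq) :
  compatible (fun n => (x n * y n) %% p ^ n)%N.
Proof.
move=> m n mn; rewrite modn_dvdm ?dvdn_exp2l//.
by rewrite -modnMm !residueP.
Qed.

Fact nat_compatible (k : nat) : compatible (fun n => k %% p ^ n)%N.
Proof. by move=> m n mn; rewrite modn_dvdm ?dvdn_exp2l. Qed.

Hypothesis p_pr : prime p.

Fact opp_compatible (x : padic_seq) :
  compatible (fun n => (p ^ n - x n) %% p ^ n)%N.
Proof.
move=> m n mn; rewrite modn_dvdm ?dvdn_exp2l//.
have pgt0 k : (0 < p ^ k)%N by rewrite expn_gt0 prime_gt0.
have ltx k : (x k < p ^ k)%N by rewrite -[x k]residue_mod ltn_mod.
apply/eqP; rewrite -(eqn_modDr (x n)) subnK ?(ltnW (ltx _))//.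
rewrite -modnDmr residueP// subnK ?(ltnW (ltx _))// modnn.
exact: dvdn_exp2l.
Qed.

End PadicIntegers.

Definition padic_int (p : nat) (p_pr : prime p) := padic_seq p.

Section PadicRing.
Variables (p : nat) (p_pr : prime p).
Local Notation Zp := (padic_int p_pr).

HB.instance Definition _ := SubChoice.on Zp.

Implicit Types x y z : Zp.

Let zero : Zp := padic_mk (nat_compatible p 0).
Let one : Zp := padic_mk (nat_compatible p 1).
Let add x y : Zp := padic_mk (add_compatible x y).
Let mul x y : Zp := padic_mk (mul_compatible x y).
Let opp x : Zp := padic_mk (opp_compatible p_pr x).

Let expp_gt0 n : (0 < p ^ n)%N.
Proof. by rewrite expn_gt0 prime_gt0. Qed.

Let residue_lt x n : (x n < p ^ n)%N.
Proof. by rewrite -[x n]residue_mod ltn_mod. Qed.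

Let addA : associative add.
Proof.
by move=> x y z; apply: padic_seqP => n /=; rewrite modnDml modnDmr addnA.
Qed.

Let addC : commutative add.
Proof. by move=> x y; apply: padic_seqP => n /=; rewrite addnC. Qed.

Let add0 : left_id zero add.
Proof.
by move=> x; apply: padic_seqP => n /=; rewrite mod0n add0n residue_mod.
Qed.

Let addN : left_inverse zero opp add.
Proof.
move=> x; apply: padic_seqP => n /=.
by rewrite modnDml subnK ?modnn ?mod0n// ltnW// residue_lt.
Qed.

HB.instance Definition _ := GRing.isZmodule.Build Zp addA addC add0 addN.

Let mulA : associative mul.
Proof.
by move=> x y z; apply: padic_seqP => n /=; rewrite modnMml modnMmr mulnA.
Qed.

Let mulC : commutative mul.
Proof. by move=> x y; apply: padic_seqP => n /=; rewrite mulnC. Qed.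

Let mul1 : left_id one mul.
Proof.
by move=> x; apply: padic_seqP => n /=; rewrite modnMml mul1n residue_mod.
Qed.

Let mulD : left_distributive mul add.
Proof.
by move=> x y z; apply: padic_seqP => n /=; rewrite modnMml modnDml modnDmr mulnDl.
Qed.

Let one_neq0 : one != zero.
Proof.
apply/eqP => /(congr1 (fun x : Zp => x 1%N)) /=.
by rewrite mod0n expn1 modn_small ?prime_gt1.
Qed.

HB.instance Definition _ :=
  GRing.Zmodule_isComNzRing.Build Zp mulA mulC mul1 mulD one_neq0.

Lemma padic0E n : (0 : Zp) n = 0%N. Proof. by rewrite /= mod0n. Qed.
Lemma padicDE x y n : (x + y) n = ((x n + y n) %% p ^ n)%N. Proof. by []. Qed.
Lemma padicME x y n : (x * y) n = ((x n * y n) %% p ^ n)%N. Proof. by []. Qed.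
Lemma padicNE x n : (- x) n = ((p ^ n - x n) %% p ^ n)%N. Proof. by []. Qed.

Lemma padic_residue0 x : x 0%N = 0%N.
Proof. by have := residue_lt x 0; rewrite expn0 ltnS leqn0 => /eqP. Qed.

Lemma padic_neq0P x : x != 0 -> exists n, x n = 0%N /\ x n.+1 != 0%N.
Proof.
move=> x0; have ex : exists n, x n != 0%N.
  apply: contrapT => /forallNP h; move/eqP: x0; apply; apply: padic_seqP => n.
  by rewrite padic0E; apply/eqP/negPn/negP/h.
case: (ex_minnP ex) => -[|n]; first by rewrite padic_residue0.
move=> xn nmin; exists n; split=> //; apply/eqP/negPn/negP => /nmin.
by rewrite ltnn.
Qed.

(* In base p, the residues of x beyond its valuation all have that valuation. *)
Lemma residue_logn x n m : x n = 0%N -> x n.+1 != 0%N -> (n < m)%N ->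
  (0 < x m)%N /\ logn p (x m) = n.
Proof.
move=> xn xn1 nm.
have xm0 : (0 < x m)%N.
  by rewrite lt0n; apply: contra xn1 => /eqP xm; rewrite -(residueP x nm) xm mod0n.
split=> //; apply/eqP; rewrite eqn_leq -(pfactor_dvdn n p_pr xm0) andbC.
rewrite /dvdn (residueP x (ltnW nm)) xn eqxx /= leqNgt.
by rewrite -(pfactor_dvdn n.+1 p_pr xm0) /dvdn (residueP x nm).
Qed.

Lemma padic_valM x y n m : x n = 0%N -> x n.+1 != 0%N ->
  y m = 0%N -> y m.+1 != 0%N ->
  (x * y) (n + m)%N = 0%N /\ (x * y) (n + m).+1 != 0%N.
Proof.
move=> xn xn1 ym ym1; pose k := (n + m).+1.
have [x0 lx] := @residue_logn x n k xn xn1 (leq_addr _ _).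
have [y0 ly] := @residue_logn y m k ym ym1 (leq_addl _ _).
have lxy : logn p (x k * y k) = (n + m)%N by rewrite lognM// lx ly.
have xy0 : (0 < x k * y k)%N by rewrite muln_gt0 x0.
split; last by rewrite padicME -/k -/(dvdn _ _) pfactor_dvdn// lxy ltnn.
rewrite -(residueP (x * y) (leqnSn _)) padicME modn_dvdm ?dvdn_exp2l//.
by apply/eqP; rewrite -/(dvdn _ _) pfactor_dvdn// lxy.
Qed.

Let padic_unit : {pred Zp} := fun x => `[< exists y, y * x = 1 >].
Let padic_inv x : Zp := xget x [set y | y * x = 1].

Let padic_mulV : {in padic_unit, left_inverse 1 padic_inv *%R}.
Proof.
by move=> x /asboolP [y yx]; rewrite /padic_inv; case: xgetP => // /(_ y).
Qed.

Let padic_unitP x y : y * x = 1 -> x \in padic_unit.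
Proof. by move=> yx; apply/asboolP; exists y. Qed.

Let padic_inv_out : {in [predC padic_unit], padic_inv =1 id}.
Proof.
move=> x /negP xNu; rewrite /padic_inv; case: xgetP => // y _ yx.
by case: xNu; apply/asboolP; exists y.
Qed.

HB.instance Definition _ := GRing.ComNzRing_hasMulInverse.Build Zp
  padic_mulV padic_unitP padic_inv_out.

Let padic_idomain x y : x * y = 0 -> (x == 0) || (y == 0).
Proof.
move=> xy; apply/negPn/negP; rewrite negb_or => /andP[].
move=> /padic_neq0P[n [xn xn1]] /padic_neq0P[m [ym ym1]].
have [_] := padic_valM xn xn1 ym ym1.
by rewrite xy padic0E.
Qed.

HB.instance Definition _ :=
  GRing.ComUnitRing_isIntegral.Build Zp padic_idomain.

End PadicRing.

Definition padic_num (p : nat) (p_pr : prime p) := {fraction (padic_int p_pr)}.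
HB.instance Definition _ (p : nat) (p_pr : prime p) :=
  GRing.Field.on (padic_num p_pr).

Section PadicDivision.
Variables (p : nat) (p_pr : prime p).
Local Notation Zp := (padic_int p_pr).
Implicit Types x y z : Zp.

Let expp_gt0 n : (0 < p ^ n)%N.
Proof. by rewrite expn_gt0 prime_gt0. Qed.

Lemma padic_unit_inv x : x 1%N != 0%N -> exists y, y * x = 1.
Proof.
move=> x1.
have cop k : coprime (x k) (p ^ k).
  case: k => [|k]; first by rewrite expn0 coprimen1.
  rewrite coprime_sym coprime_pexpl// prime_coprime//.
  by rewrite /dvdn -{2}[p]expn1 (residueP x).
pose u k := (x k ^ (totient (p ^ k)).-1 %% p ^ k)%N.
have ux k : (u k * x k = 1 %[mod p ^ k])%N.
  rewrite /u modnMml -expnSr prednK ?totient_gt0//.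
  exact/Euler_exp_totient/cop.
have hu : compatible p u.
  move=> m n mn; have pp : (p ^ m %| p ^ n)%N by rewrite dvdn_exp2l.
  have unx : (u n * x m = 1 %[mod p ^ m])%N.
    by rewrite -(residueP x mn) modnMmr -(modn_dvdm _ pp) ux modn_dvdm.
  have -> : u m = (u m %% p ^ m)%N by rewrite /u modn_mod.
  rewrite -[u n]muln1 -modnMmr -(ux m) modnMmr (mulnC (u m)) mulnA.
  by rewrite -modnMml unx modnMml mul1n.
exists (padic_mk hu); apply: padic_seqP => n.
by rewrite padicME /= ux.
Qed.

Lemma padic_natE m n : (m%:R : Zp) n = (m %% p ^ n)%N.
Proof.
elim: m => [|m IH]; first by rewrite padic0E mod0n.
by rewrite -natr1 padicDE IH modnDm addn1.
Qed.

Lemma padic_shift x n : x n = 0%N -> exists y,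
  x = (p%:R : Zp) ^+ n * y /\ (x n.+1 != 0%N -> y 1%N != 0%N).
Proof.
move=> xn; pose f k := (x (n + k) %/ p ^ n)%N.
have dv k : (p ^ n %| x (n + k))%N.
  by rewrite /dvdn (residueP x (leq_addr _ _)) xn.
have hf : compatible p f.
  move=> k l kl; rewrite /f.
  apply/eqP; rewrite -(eqn_pmul2r (expp_gt0 n)) muln_modl divnK//.
  by rewrite divnK// -expnD (addnC k) (residueP x) ?leq_add2l.
exists (padic_mk hf); split.
  apply: padic_seqP => k; rewrite -natrX padicME padic_natE /= modnMml /f.
  by rewrite mulnC divnK// (residueP x (leq_addl _ _)).
move=> xn1 /=; rewrite /f addn1.
apply: contra xn1 => /eqP h.
by rewrite -addn1 -(divnK (dv 1%N)) addn1 h mul0n.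
Qed.

End PadicDivision.

Section PadicAbsoluteValue.
Variables (R : realType) (p : nat) (p_pr : prime p).
Local Notation Zp := (padic_int p_pr).
Local Notation Qp := (padic_num p_pr).
Implicit Types x y z : Zp.

Definition padic_int_val x : nat :=
  xget 0%N [set n | x n = 0%N /\ x n.+1 != 0%N].

Definition padic_int_abs x : R :=
  if x == 0 then 0 else p%:R ^- padic_int_val x.

Definition padic_abs (a : Qp) : R :=
  padic_int_abs \n_(repr a) / padic_int_abs \d_(repr a).

Local Notation pR := (p%:R : R).

Lemma prime_R_gt1 : 1 < pR. Proof. by rewrite ltr1n prime_gt1. Qed.
Lemma prime_R_gt0 : 0 < pR. Proof. by rewrite ltr0n prime_gt0. Qed.
Lemma prime_RX_gt0 n : 0 < pR ^- n. Proof. by rewrite invr_gt0 exprn_gt0 ?prime_R_gt0. Qed.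

Lemma prime_RX_le n m : (pR ^- n <= pR ^- m) = (m <= n)%N.
Proof.
rewrite lef_pV2 ?posrE ?exprn_gt0 ?prime_R_gt0//.
by rewrite ler_eXn2l// prime_R_gt1.
Qed.

Lemma padic_int_valP x : x != 0 ->
  x (padic_int_val x) = 0%N /\ x (padic_int_val x).+1 != 0%N.
Proof.
move=> /padic_neq0P[n xn]; rewrite /padic_int_val.
by case: xgetP => [m _ //|/(_ n)].
Qed.

Lemma padic_int_val_unique x n :
  x n = 0%N -> x n.+1 != 0%N -> padic_int_val x = n.
Proof.
move=> xn xn1; have x0 : x != 0.
  by apply: contra xn1 => /eqP ->; rewrite padic0E.
have [vn vn1] := padic_int_valP x0.
have mono k l : (k <= l)%N -> x l = 0%N -> x k = 0%N.
  by move=> kl xl; rewrite -(residueP x kl) xl mod0n.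
apply/eqP; rewrite eqn_leq; apply/andP; split; rewrite leqNgt; apply/negP => h.
  by rewrite (mono _ _ h vn) in xn1.
by rewrite (mono _ _ h xn) in vn1.
Qed.

Lemma padic_int_abs_ge0 x : 0 <= padic_int_abs x.
Proof. by rewrite /padic_int_abs; case: ifP => // _; exact/ltW/prime_RX_gt0. Qed.

Lemma padic_int_abs_eq0 x : (padic_int_abs x == 0) = (x == 0).
Proof.
rewrite /padic_int_abs; case: ifP => [|_]; first by rewrite eqxx.
by rewrite gt_eqF// prime_RX_gt0.
Qed.

Lemma padic_int_abs0 : padic_int_abs 0 = 0.
Proof. by rewrite /padic_int_abs eqxx. Qed.

Lemma padic_int_abs1 : padic_int_abs 1 = 1.
Proof.
rewrite /padic_int_abs oner_eq0 (@padic_int_val_unique 1 0%N) ?expr0 ?invr1//.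
by rewrite (padic_natE p_pr 1) expn1 modn_small ?prime_gt1.
Qed.

Lemma padic_int_abs_le x n : (padic_int_abs x <= pR ^- n) = (x n == 0%N).
Proof.
rewrite /padic_int_abs; case: ifPn => [/eqP->|x0].
  by rewrite padic0E eqxx (ltW (prime_RX_gt0 _)).
have [xv xv1] := padic_int_valP x0; rewrite prime_RX_le.
apply/idP/eqP => [nv|xn]; first by rewrite -(residueP x nv) xv mod0n.
rewrite leqNgt; apply: contra xv1 => h.
by rewrite -(residueP x h) xn mod0n.
Qed.

Lemma padic_int_abs_le1 x : padic_int_abs x <= 1.
Proof. by have := padic_int_abs_le x 0; rewrite expr0 invr1 padic_residue0 eqxx. Qed.

Lemma padic_int_absM x y :
  padic_int_abs (x * y) = padic_int_abs x * padic_int_abs y.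
Proof.
rewrite /padic_int_abs mulf_eq0; case: eqVneq => [|x0] /=; first by rewrite mul0r.
case: eqVneq => [|y0] /=; first by rewrite mulr0.
have [xv xv1] := padic_int_valP x0; have [yv yv1] := padic_int_valP y0.
have [h h1] := padic_valM xv xv1 yv yv1.
by rewrite (padic_int_val_unique h h1) exprD invfM.
Qed.

Lemma padic_int_absN x : padic_int_abs (- x) = padic_int_abs x.
Proof.
suff le z : padic_int_abs (- z) <= padic_int_abs z.
  by apply/eqP; rewrite eq_le le -{1}[x]opprK le.
rewrite [leRHS]/padic_int_abs; case: ifPn => [/eqP->|z0].
  by rewrite oppr0 padic_int_abs0.
have [zv _] := padic_int_valP z0.
by rewrite padic_int_abs_le padicNE zv subn0 modnn.
Qed.

Lemma padic_int_absD x y :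
  padic_int_abs (x + y) <= Num.max (padic_int_abs x) (padic_int_abs y).
Proof.
have dom n : padic_int_abs x <= pR ^- n -> padic_int_abs y <= pR ^- n ->
    padic_int_abs (x + y) <= pR ^- n.
  by rewrite !padic_int_abs_le padicDE => /eqP-> /eqP->; rewrite mod0n.
case: (eqVneq x 0) => [->|x0]; first by rewrite add0r le_max lexx orbT.
case: (eqVneq y 0) => [->|y0]; first by rewrite addr0 le_max lexx.
have ex z : z != 0 -> padic_int_abs z = pR ^- (padic_int_val z).
  by rewrite /padic_int_abs => /negPf->.
case: (leP (padic_int_abs x) (padic_int_abs y)) => h.
  by rewrite (ex y y0); apply: dom; rewrite -(ex y y0).
by rewrite (ex x x0); apply: dom; rewrite -(ex x x0)// ltW.
Qed.

Lemma padic_int_abs_dvd x y : y != 0 -> padic_int_abs x <= padic_int_abs y ->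
  exists z, x = z * y.
Proof.
move=> y0; have [yv yv1] := padic_int_valP y0; move: yv yv1.
rewrite {2}/padic_int_abs (negPf y0); set n := padic_int_val y => yv yv1.
rewrite padic_int_abs_le => /eqP xn.
have [x' [-> _]] := padic_shift xn.
have [y' [yE /(_ yv1) /padic_unit_inv[u uy]]] := padic_shift yv; rewrite yE.
by exists (x' * u); rewrite -mulrA (mulrCA u) uy mulr1 mulrC.
Qed.

Implicit Types a b c : Qp.
Local Notation frac := (@FracField.tofrac (padic_int p_pr)).

Lemma padic_numE a : a = frac \n_(repr a) / frac \d_(repr a).
Proof.
have d0 := denom_ratioP (repr a).
rewrite -{1}[a]reprK; unlock FracField.tofrac.
rewrite -[X in _ = _ * X]FracField.pi_inv -[RHS]FracField.pi_mul.
rewrite /FracField.mulf /FracField.invf /= !numden_Ratio ?(oner_eq0, mul1r, mulr1)//.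
by rewrite Ratio_numden.
Qed.

Lemma padic_abs_frac x y : y != 0 ->
  padic_abs (frac x / frac y) = padic_int_abs x / padic_int_abs y.
Proof.
move=> y0; set a := _ / _; rewrite /padic_abs.
have d0 := denom_ratioP (repr a).
have : frac (x * \d_(repr a)) = frac (\n_(repr a) * y).
  have /(congr1 (fun u => u * (frac y * frac \d_(repr a)))) := padic_numE a.
  rewrite [in RHS]mulrA [in RHS](mulrAC _ _ (frac y)) divfK ?tofrac_eq0//.
  by rewrite mulrA divfK ?tofrac_eq0// !tofracM => ->.
move/eqP; rewrite tofrac_eq => /eqP /(congr1 padic_int_abs).
rewrite !padic_int_absM => e; apply/eqP.
by rewrite eqr_div ?padic_int_abs_eq0// e.
Qed.

Lemma padic_abs_int x : padic_abs (frac x) = padic_int_abs x.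
Proof.
rewrite -[frac x]divr1 -[1 in LHS]tofrac1 padic_abs_frac ?oner_eq0//.
by rewrite padic_int_abs1 divr1.
Qed.

Lemma padic_abs_ge0 a : 0 <= padic_abs a.
Proof. by rewrite divr_ge0// padic_int_abs_ge0. Qed.

Lemma padic_abs_eq0 a : (padic_abs a == 0) = (a == 0).
Proof.
rewrite /padic_abs [in RHS](padic_numE a) !mulf_eq0 !invr_eq0.
by rewrite !padic_int_abs_eq0 !tofrac_eq0.
Qed.

Lemma padic_abs0 : padic_abs 0 = 0.
Proof. by apply/eqP; rewrite padic_abs_eq0. Qed.

Lemma padic_absM a b : padic_abs (a * b) = padic_abs a * padic_abs b.
Proof.
rewrite [in LHS](padic_numE a) [in LHS](padic_numE b).
rewrite mulrACA -invfM -!tofracM padic_abs_frac ?mulf_neq0 ?denom_ratioP//.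
by rewrite !padic_int_absM invfM mulrACA.
Qed.

Lemma padic_abs1 : padic_abs 1 = 1.
Proof. by rewrite -[1 in LHS]tofrac1 padic_abs_int padic_int_abs1. Qed.

Lemma padic_absV a : padic_abs a^-1 = (padic_abs a)^-1.
Proof.
case: (eqVneq a 0) => [->|a0]; first by rewrite invr0 padic_abs0 invr0.
apply: (mulfI (_ : padic_abs a != 0)); first by rewrite padic_abs_eq0.
by rewrite -padic_absM !divff ?padic_abs_eq0// padic_abs1.
Qed.

Lemma padic_absD a b : padic_abs (a + b) <= Num.max (padic_abs a) (padic_abs b).
Proof.
rewrite [in leLHS](padic_numE a) [in leLHS](padic_numE b).
have da := denom_ratioP (repr a); have db := denom_ratioP (repr b).
rewrite addf_div ?tofrac_eq0// -!tofracM -tofracD padic_abs_frac ?mulf_neq0//.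
rewrite padic_int_absM ler_pdivrMr; last first.
  by rewrite lt_def mulf_neq0 ?padic_int_abs_eq0// mulr_ge0// padic_int_abs_ge0.
apply: (le_trans (padic_int_absD _ _)).
rewrite !padic_int_absM maxr_pMl ?mulr_ge0 ?padic_int_abs_ge0//.
rewrite /padic_abs mulrA divfK ?padic_int_abs_eq0//.
by rewrite (mulrC (padic_int_abs \d_(repr a))) mulrA divfK ?padic_int_abs_eq0.
Qed.

Lemma padic_absN a : padic_abs (- a) = padic_abs a.
Proof.
have e : padic_abs (-1) = 1.
  by rewrite -[1 in LHS]tofrac1 -tofracN padic_abs_int padic_int_absN padic_int_abs1.
by rewrite -mulN1r padic_absM e mul1r.
Qed.

Lemma padic_absB a b : padic_abs (a - b) <= Num.max (padic_abs a) (padic_abs b).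
Proof. by rewrite -(padic_absN b); exact: padic_absD. Qed.

Lemma padic_absP a : (exists x, a = frac x) <-> padic_abs a <= 1.
Proof.
split=> [[x ->]|]; first by rewrite padic_abs_int padic_int_abs_le1.
have d0 := denom_ratioP (repr a).
rewrite ler_pdivrMr ?mul1r ?lt_def ?padic_int_abs_eq0 ?d0 ?padic_int_abs_ge0//.
move=> /(padic_int_abs_dvd d0)[z nz]; exists z.
by rewrite [LHS]padic_numE nz tofracM mulfK ?tofrac_eq0.
Qed.

Lemma padic_int_abs_p : padic_int_abs p%:R = pR^-1.
Proof.
rewrite /padic_int_abs; case: ifPn => [/eqP p0|_].
  have /(congr1 (fun x : Zp => x 2%N)) := p0.
  rewrite padic_natE padic0E modn_small => [p0'|].
    by have := prime_gt0 p_pr; rewrite p0'.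
  by rewrite -{1}[p]expn1 ltn_exp2l// prime_gt1.
rewrite (@padic_int_val_unique _ 1%N) ?expr1//; first by rewrite padic_natE expn1 modnn.
rewrite padic_natE modn_small; first by rewrite -lt0n prime_gt0.
by rewrite -{1}[p]expn1 ltn_exp2l// prime_gt1.
Qed.

Lemma padic_abs_lt a b :
  padic_abs a < padic_abs b -> padic_abs a <= padic_abs (frac p%:R * b).
Proof.
case: (eqVneq b 0) => [->|b0].
  by rewrite padic_abs0 ltNge padic_abs_ge0.
have b_gt0 : 0 < padic_abs b by rewrite lt_def padic_abs_eq0 b0 padic_abs_ge0.
rewrite padic_absM -[_ * padic_abs b](mulrC (padic_abs b)) mulrC.
rewrite -ler_pdivrMr// -[X in X < _ -> _]divr1 => ab.
have {ab} : padic_abs (a / b) < 1.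
  by rewrite padic_absM padic_absV ltr_pdivrMr// mul1r -[X in X < _]divr1.
rewrite -padic_absV -padic_absM.
move=> lt1; have [x xE] := (padic_absP _).2 (ltW lt1).
rewrite xE !padic_abs_int in lt1 *.
have : x 1%N == 0%N.
  apply/negPn/negP => x1; suff e : padic_int_val x = 0%N.
    move: lt1; rewrite /padic_int_abs e expr0 invr1; case: ifP; rewrite ?ltxx//.
    by move=> /eqP x0; rewrite x0 padic0E in x1.
  by apply: padic_int_val_unique => //; exact: padic_residue0.
rewrite -padic_int_abs_le => /le_trans; apply.
by rewrite padic_int_abs_p expr1.
Qed.

End PadicAbsoluteValue.

Section PadicFunctions.
Variables (p : nat) (p_pr : prime p).
Local Notation Zp := (padic_int p_pr).
Local Notation Qp := (padic_num p_pr).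
Local Notation frac := (@FracField.tofrac (padic_int p_pr)).

Definition padic_integral : {pred Qp} := fun a => `[< exists z : Zp, a = frac z >].

Lemma padic_integralP (R : realType) (a : Qp) :
  reflect (padic_abs R a <= 1) (a \in padic_integral).
Proof. by apply: (iffP (asboolP _)) => /padic_absP. Qed.

Lemma padic_integral_frac (z : Zp) : frac z \in padic_integral.
Proof. by apply/asboolP; exists z. Qed.

Fact padic_integral_zmod_closed : zmod_closed padic_integral.
Proof.
split=> [|a b /asboolP[y ->] /asboolP[z ->]].
  by rewrite -tofrac0 padic_integral_frac.
by rewrite -tofracB padic_integral_frac.
Qed.

HB.instance Definition _ :=
  GRing.isZmodClosed.Build Qp padic_integral padic_integral_zmod_closed.

Lemma padic_integralM a b :
  a \in padic_integral -> b \in padic_integral -> a * b \in padic_integral.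
Proof.
move=> /asboolP[y ->] /asboolP[z ->].
by rewrite -tofracM padic_integral_frac.
Qed.

Definition padic_quot := Quotient.quot padic_integral.
HB.instance Definition _ := GRing.Zmodule.on padic_quot.

Lemma padic_quotP (a b : Qp) :
  reflect (\pi_(padic_quot)%qT a = \pi_(padic_quot)%qT b) (a - b \in padic_integral).
Proof. by rewrite Quotient.idealrBE; exact: eqP. Qed.

Variable X : pointedType.

Definition almost_integral : {pred X -> Qp} :=
  fun f => `[< finite_set [set x | f x \notin padic_integral] >].

Fact almost_integral_zmod_closed : zmod_closed almost_integral.
Proof.
split=> [|f g /asboolP hf /asboolP hg]; apply/asboolP.
  rewrite (_ : [set x | _] = set0) ?finite_set0//.
  by rewrite -subset0 => x /=; rewrite rpred0.
apply: (sub_finite_set _ (_ : finite_set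
  ([set x | f x \notin padic_integral] `|` [set x | g x \notin padic_integral]))).
  move=> x /= hx; apply/orP; rewrite -negb_and; apply: contra hx => /andP[? ?].
  exact: rpredB.
by rewrite finite_setU.
Qed.

HB.instance Definition _ :=
  GRing.isZmodClosed.Build _ almost_integral almost_integral_zmod_closed.

Record padic_fun := PadicFun {
  padic_fun_val :> X -> Qp;
  _ : padic_fun_val \in almost_integral }.

HB.instance Definition _ := [isSub for padic_fun_val].
HB.instance Definition _ := [Choice of padic_fun by <:].
HB.instance Definition _ := [SubChoice_isSubZmodule of padic_fun by <:].

Implicit Types (xi eta : padic_fun).

Lemma padic_funP xi eta : (forall x, xi x = eta x) -> xi = eta.
Proof. by move=> h; apply/val_inj/funext => x; exact: h. Qed.

Lemma padic_fun_fin xi : finite_set [set x | xi x \notin padic_integral].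
Proof. by case: xi => f /= /asboolP. Qed.

Lemma padic_funD xi eta x : (xi + eta) x = xi x + eta x. Proof. by []. Qed.
Lemma padic_funN xi x : (- xi) x = - xi x. Proof. by []. Qed.
Lemma padic_funB xi eta x : (xi - eta) x = xi x - eta x. Proof. by []. Qed.
Lemma padic_fun0 x : (0 : padic_fun) x = 0. Proof. by []. Qed.

Fact padic_fun_scale_subproof (k : Zp) xi :
  (fun x => frac k * xi x) \in almost_integral.
Proof.
apply/asboolP; apply: (sub_finite_set _ (padic_fun_fin xi)) => x /=.
by apply: contra => /(padic_integralM (padic_integral_frac k)).
Qed.

Definition padic_fun_scale (k : Zp) xi := PadicFun (padic_fun_scale_subproof k xi).

Fact padic_fun_scaleA a b xi :
  padic_fun_scale a (padic_fun_scale b xi) = padic_fun_scale (a * b) xi.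
Proof. by apply: padic_funP => x /=; rewrite tofracM mulrA. Qed.

Fact padic_fun_scale1 : left_id 1 padic_fun_scale.
Proof. by move=> xi; apply: padic_funP => x /=; rewrite tofrac1 mul1r. Qed.

Fact padic_fun_scaleDr : right_distributive padic_fun_scale +%R.
Proof. by move=> k xi eta; apply: padic_funP => x /=; rewrite mulrDr. Qed.

Fact padic_fun_scaleDl xi : {morph padic_fun_scale^~ xi : a b / a + b}.
Proof. by move=> a b; apply: padic_funP => x /=; rewrite tofracD mulrDl. Qed.

HB.instance Definition _ := GRing.Zmodule_isLmodule.Build Zp padic_fun
  padic_fun_scaleA padic_fun_scale1 padic_fun_scaleDr padic_fun_scaleDl.

Lemma padic_funZ (k : Zp) xi x : (k *: xi) x = frac k * xi x. Proof. by []. Qed.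

(* The sum runs over the finitely many x whose term is nonzero in Q_p / Z_p. *)
Definition pairing xi eta : padic_quot :=
  \sum_(x \in [set: X]) \pi_(padic_quot)%qT (xi x * eta x).

Fact delta_subproof x :
  (fun y => if y == x then 1 else 0 : Qp) \in almost_integral.
Proof.
apply/asboolP; rewrite (_ : [set y | _] = set0) ?finite_set0// -subset0 => y /=.
by case: ifP => _; rewrite -?tofrac1 -?tofrac0 padic_integral_frac.
Qed.

Definition delta x := PadicFun (delta_subproof x).

End PadicFunctions.
Arguments delta {p p_pr X} x.

Section PadicOperators.
Variables (R : realType) (p : nat) (p_pr : prime p).
Local Notation Zp := (padic_int p_pr).
Local Notation Qp := (padic_num p_pr).
Local Notation frac := (@FracField.tofrac (padic_int p_pr)).
Local Notation pabs := (padic_abs R).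
Local Notation integral := (@padic_integral _ p_pr).

Section Norm.
Variable X : pointedType.
Local Notation QpX := (padic_fun p_pr X).
Implicit Types (xi eta : QpX) (P : set X).

Definition sup_norm xi : \bar R := ereal_sup [set (pabs (xi x))%:E | x in [set: X]].

Lemma sup_norm_le xi (r : R) :
  (sup_norm xi <= r%:E)%E <-> (forall x, pabs (xi x) <= r).
Proof.
split=> [h x|h].
  rewrite -lee_fin; apply: le_trans h; apply: ereal_sup_ubound.
  by exists x.
by apply: ge_ereal_sup => _ [x _ <-]; rewrite lee_fin.
Qed.

Lemma sup_norm_le1 xi : (sup_norm xi <= 1)%E <-> (forall x, xi x \in integral).
Proof.
rewrite (sup_norm_le xi 1); split=> h x; first exact/(padic_integralP R).
exact/(padic_integralP R)/h.
Qed.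

(* U_P, the product of the Q_p for x in P and of the Z_p for x outside P. *)
Definition box P : set QpX := [set xi | forall x, ~ P x -> xi x \in integral].

(* The trace of U on each box is open for the product topology: a neighbourhood
   base of xi in that topology is given by the sets of the eta in the box with
   |eta x - xi x| < e at the points x of a finite set F. *)
Definition tau_open (U : set QpX) :=
  forall P, finite_set P -> forall xi, (U `&` box P) xi ->
    exists F : set X, finite_set F /\ exists e : R, 0 < e /\
      forall eta, box P eta -> (forall x, F x -> pabs (eta x - xi x) < e) -> U eta.

End Norm.

Section Operators.
Variable X : pointedType.
Local Notation QpX := (padic_fun p_pr X).
Implicit Types (xi eta : QpX) (T S : QpX -> QpX).

Definition tau_continuous T := forall U, tau_open U -> tau_open (T @^-1` U).

Definition op_norm T : \bar R :=
  ereal_sup [set sup_norm (T xi) | xi in [set xi | (sup_norm xi <= 1)%E]].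

Definition contractive_operator : {pred QpX -> QpX} :=
  fun T => `[< [/\ linear T, tau_continuous T & (op_norm T <= 1)%E] >].

Lemma op_norm_le T (r : R) : (op_norm T <= r%:E)%E <->
  (forall xi, (forall x, xi x \in integral) -> forall x, pabs (T xi x) <= r).
Proof.
split=> [h xi /sup_norm_le1 hxi|h].
  by apply/sup_norm_le; apply: le_trans h; apply: ereal_sup_ubound; exists xi.
by apply: ge_ereal_sup => _ [xi /= /sup_norm_le1 hxi <-]; apply/sup_norm_le/h.
Qed.

Lemma op_norm_le1 T : (op_norm T <= 1)%E <->
  (forall xi, (forall x, xi x \in integral) -> forall x, T xi x \in integral).
Proof.
rewrite (op_norm_le T 1); split=> h xi hxi x; first exact/(padic_integralP R)/h.
exact/(padic_integralP R)/h.
Qed.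

Lemma linear_op0 T : linear T -> T 0 = 0.
Proof.
by move=> /(_ (-1) 0 0); rewrite scaler0 addr0 scaleN1r addNr.
Qed.

Lemma linear_opD T : linear T -> {morph T : xi eta / xi + eta}.
Proof. by move=> lT xi eta; rewrite -[xi in LHS]scale1r lT scale1r. Qed.

Lemma linear_opZ T : linear T -> forall k xi, T (k *: xi) = k *: T xi.
Proof. by move=> lT k xi; rewrite -[_ *: xi in LHS]addr0 lT linear_op0// addr0. Qed.

(* For a contractive linear map, tau-continuity is continuity at 0 on Z_p^X. *)
Lemma tau_continuousP T : linear T -> (op_norm T <= 1)%E ->
  tau_continuous T <->
  (forall F : set X, finite_set F -> forall e : R, 0 < e ->
    exists G : set X, finite_set G /\ exists d : R, 0 < d /\
      forall xi, (forall x, xi x \in integral) ->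
        (forall x, G x -> pabs (xi x) < d) ->
      forall x, F x -> pabs (T xi x) < e).
Proof.
move=> lT /op_norm_le1 T1; split=> [cT F finF e e0|cT U Uo P finP xi [/= UT Pxi]].
  pose U := [set eta : QpX | forall x, F x -> pabs (eta x) < e].
  have Uo : tau_open U.
    move=> P finP xi [Uxi _]; exists F; split=> //; exists e; split=> // eta _ h x Fx.
    rewrite -(subrK (xi x) (eta x)); apply: (le_lt_trans (padic_absD _ _ _)).
    by rewrite gt_max h//= Uxi.
  have [|G [finG [d [d0 h]]]] := cT U Uo set0 (finite_set0 _) 0.
    split; last by move=> x _; rewrite padic_fun0 rpred0.
    by move=> /= x Fx; rewrite (linear_op0 lT) padic_fun0 padic_abs0.
  exists G; split=> //; exists d; split=> // xi hxi Gxi.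
  by apply: h => [x _ //|x Gx]; rewrite padic_fun0 subr0 Gxi.
pose P' := [set x | T xi x \notin integral].
have finP' : finite_set P' by exact: padic_fun_fin.
have [|F [finF [e [e0 hU]]]] := Uo P' finP' (T xi).
  by split=> // x /negP; rewrite negbK.
have [G [finG [d [d0 hT]]]] := cT F finF e e0.
exists (G `|` P); split; first by rewrite finite_setU.
exists (Num.min d 1); split; first by rewrite lt_min d0 ltr01.
move=> eta Peta h /=; set z := eta - xi.
have zI x : z x \in integral.
  case: (pselect (P x)) => [Px|nPx].
    have /(_ x (or_intror Px)) := h; rewrite lt_min => /andP[_ /ltW].
    by move/(padic_integralP R).
  by rewrite padic_funB rpredB// ?Peta ?Pxi.
have zG x : G x -> pabs (z x) < d.
  by move=> Gx; have /(_ x (or_introl Gx)) := h; rewrite lt_min => /andP[].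
have TE : T eta = T z + T xi by rewrite -[in LHS](subrK xi eta) -/z linear_opD.
apply: hU => [x nP'x|x Fx].
  rewrite TE padic_funD; apply: rpredD; first exact: T1.
  by apply: contrapT => /negP.
by rewrite TE padic_funD addrK; exact: hT.
Qed.

Fact contractive_submod_closed : submod_closed contractive_operator.
Proof.
split=> [|k T S /asboolP[lT cT T1] /asboolP[lS cS S1]]; apply/asboolP.
  have l0 : linear (0 : QpX -> QpX) by move=> k xi eta; rewrite scaler0 addr0.
  have n0 : (op_norm (0%R : QpX -> QpX) <= 1)%E.
    by apply/op_norm_le1 => xi _ x; exact: rpred0.
  split=> //; apply/tau_continuousP => // F finF e e0.
  exists set0; split=> //; exists 1; split=> // xi _ _ x _.
  by rewrite padic_fun0 padic_abs0.
have lTS : linear (k *: T + S).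
  move=> a xi eta; change (k *: T (a *: xi + eta) + S (a *: xi + eta) =
    a *: (k *: T xi + S xi) + (k *: T eta + S eta)).
  by rewrite lT lS !scalerDr !scalerA [k * a]mulrC addrACA.
have hk (a : Qp) : pabs (frac k * a) <= pabs a.
  rewrite padic_absM padic_abs_int ler_piMl ?padic_abs_ge0//.
  exact: padic_int_abs_le1.
have TS1 : (op_norm (k *: T + S)%R <= 1)%E.
  move: T1 S1 => /op_norm_le1 T1 /op_norm_le1 S1; apply/op_norm_le1 => xi hxi x.
  apply: rpredD; last exact: S1.
  by apply: padic_integralM; [exact: padic_integral_frac|exact: T1].
split=> //; apply/tau_continuousP => // F finF e e0.
have [G [finG [d [d0 hT]]]] := (tau_continuousP lT T1).1 cT F finF e e0.
have [H [finH [c [c0 hS]]]] := (tau_continuousP lS S1).1 cS F finF e e0.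
exists (G `|` H); split; first by rewrite finite_setU.
exists (Num.min d c); split; first by rewrite lt_min d0.
move=> xi hxi hGH x Fx; apply: (le_lt_trans (padic_absD _ _ _)).
rewrite gt_max; apply/andP; split.
  apply: (le_lt_trans (hk _)); apply: hT => // y Gy.
  by have /(_ y (or_introl Gy)) := hGH; rewrite lt_min => /andP[].
apply: hS => // y Hy.
by have /(_ y (or_intror Hy)) := hGH; rewrite lt_min => /andP[].
Qed.

HB.instance Definition _ := GRing.isSubmodClosed.Build Zp (QpX -> QpX)
  contractive_operator contractive_submod_closed.

(* B_{<=1}(Q_p(X)) *)
Record contraction := Contraction {
  contraction_fun :> QpX -> QpX;
  _ : contraction_fun \in contractive_operator }.

HB.instance Definition _ := [isSub for contraction_fun].
HB.instance Definition _ := [Choice of contraction by <:].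
HB.instance Definition _ := [SubChoice_isSubLmodule of contraction by <:].

End Operators.

Section Contractions.
Variable X : pointedType.
Local Notation QpX := (padic_fun p_pr X).
Local Notation B := (contraction X).
Implicit Types (xi eta : QpX) (T S : B).

Lemma contractionP T : [/\ linear T, tau_continuous T & (op_norm T <= 1)%E].
Proof. by case: T => f /= /asboolP. Qed.

Lemma contraction_eqP T S : (forall xi, T xi = S xi) -> T = S.
Proof. by move=> h; apply/val_inj/funext => xi; exact: h. Qed.

Lemma contractionD T S xi : (T + S) xi = T xi + S xi. Proof. by []. Qed.
Lemma contractionB T S xi : (T - S) xi = T xi - S xi. Proof. by []. Qed.
Lemma contractionZ k T xi : (k *: T) xi = k *: T xi. Proof. by []. Qed.
Lemma contraction0 xi : (0 : B) xi = 0. Proof. by []. Qed.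

Lemma contraction_integral T xi :
  (forall x, xi x \in integral) -> forall x, T xi x \in integral.
Proof. by have [_ _ /op_norm_le1] := contractionP T; apply. Qed.

Fact comp_subproof T S : (T \o S) \in @contractive_operator X.
Proof.
have [lT cT _] := contractionP T; have [lS cS _] := contractionP S.
apply/asboolP; split=> [k xi eta /=|U Uo|]; first by rewrite lS lT.
  by rewrite comp_preimage; exact/cS/cT.
by apply/op_norm_le1 => xi hxi x /=; do 2!apply: contraction_integral => ?.
Qed.

Definition contraction_mul T S : B := Contraction (comp_subproof T S).

Definition contraction_norm T : R := fine (op_norm T).

(* T^* is the unique contraction with <T xi, eta> = <xi, T^* eta>; the default
   value 0 of xget is never reached. *)
Definition adjoint T : B :=
  xget 0 [set S : B | forall xi eta, pairing (T xi) eta = pairing xi (S eta)].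

Lemma op_norm_fin T : op_norm T \is a fin_num.
Proof.
have [_ _ T1] := contractionP T.
rewrite ge0_fin_numE; first by rewrite (le_lt_trans T1) ?ltry.
apply: (@le_trans _ _ (sup_norm (T 0))).
  apply: (@le_trans _ _ (pabs (T 0 point))%:E); first by rewrite lee_fin padic_abs_ge0.
  by apply: ereal_sup_ubound; exists point.
apply: ereal_sup_ubound; exists 0 => //=.
by apply/sup_norm_le1 => x; exact: rpred0.
Qed.

Lemma contraction_norm_le T (r : R) : contraction_norm T <= r <->
  (forall xi, (forall x, xi x \in integral) -> forall x, pabs (T xi x) <= r).
Proof. by rewrite -op_norm_le -lee_fin fineK ?op_norm_fin. Qed.

Lemma contraction_norm_ub T xi x : (forall x, xi x \in integral) ->
  pabs (T xi x) <= contraction_norm T.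
Proof. by move=> hxi; exact/(contraction_norm_le T _).1. Qed.

Lemma contraction_norm_le1 T : contraction_norm T <= 1.
Proof.
apply/contraction_norm_le => xi hxi x.
exact/(padic_integralP R)/contraction_integral.
Qed.

Lemma contraction_norm_ge0 T : 0 <= contraction_norm T.
Proof.
apply: (le_trans (padic_abs_ge0 R (T 0 point))).
by apply: contraction_norm_ub => x; exact: rpred0.
Qed.

Lemma contraction_normD T S :
  contraction_norm (T + S) <= Num.max (contraction_norm T) (contraction_norm S).
Proof.
apply/contraction_norm_le => xi hxi x; rewrite contractionD padic_funD.
apply: (le_trans (padic_absD _ _ _)).
by rewrite ge_max !le_max !contraction_norm_ub ?orbT.
Qed.

Lemma contraction_normZ k T :
  contraction_norm (k *: T) <= padic_int_abs R k * contraction_norm T.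
Proof.
apply/contraction_norm_le => xi hxi x; rewrite contractionZ padic_funZ.
rewrite padic_absM padic_abs_int ler_wpM2l ?padic_int_abs_ge0//.
exact: contraction_norm_ub.
Qed.

Lemma padic_fun_normalize xi : (forall x, xi x \in integral) -> xi != 0 ->
  exists k eta x, [/\ xi = k *: eta, (forall y, eta y \in integral) &
    xi x = frac k].
Proof.
move=> hxi xi0.
pose Q n := `[< exists x, xi x != 0 /\ exists z, xi x = frac z /\ padic_int_val z = n >].
have ex : exists n, Q n.
  apply: contrapT => /forallNP h; move/eqP: xi0; apply; apply: padic_funP => x.
  apply/eqP/negPn/negP => xix; have /asboolP[z zE] := hxi x.
  by case: (h (padic_int_val z)); apply/asboolP; exists x; split=> //; exists z.
case: (ex_minnP ex) => n /asboolP[x [xix [k [kE kn]]]] nmin.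
have k0 : k != 0 by rewrite -tofrac_eq0 -kE.
have hy y : xi y / frac k \in integral.
  apply/(padic_integralP R); rewrite padic_absM padic_absV.
  rewrite ler_pdivrMr ?mul1r ?lt_def ?padic_abs_ge0 ?padic_abs_eq0 ?tofrac_eq0 ?k0//.
  have /asboolP[z zE] := hxi y.
  rewrite zE !padic_abs_int /padic_int_abs (negPf k0) kn.
  case: ifPn => [_|z0]; first exact/ltW/prime_RX_gt0.
  rewrite prime_RX_le//; apply: nmin; apply/asboolP.
  by exists y; rewrite zE tofrac_eq0 z0; split=> //; exists z.
have h : (fun y => xi y / frac k) \in @almost_integral _ p_pr X.
  apply/asboolP; rewrite (_ : [set y | _] = set0) ?finite_set0// -subset0 => y /=.
  by rewrite hy.
exists k, (PadicFun h), x; split=> //; apply: padic_funP => y.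
by rewrite padic_funZ /= mulrC divfK ?tofrac_eq0.
Qed.

Lemma contraction_normM T S : contraction_norm (contraction_mul T S) <=
  contraction_norm T * contraction_norm S.
Proof.
have [lT _ _] := contractionP T.
apply/contraction_norm_le => xi hxi x /=.
have hS := contraction_integral S hxi.
case: (eqVneq (S xi) 0) => [->|S0].
  by rewrite linear_op0// padic_fun0 padic_abs0 mulr_ge0// contraction_norm_ge0.
have [k [eta [y [SE heta yE]]]] := padic_fun_normalize hS S0.
rewrite SE (linear_opZ lT) padic_funZ padic_absM -yE mulrC.
rewrite ler_pM ?padic_abs_ge0//; exact: contraction_norm_ub.
Qed.

Lemma pairing_adjoint_le T S :
  (forall xi eta, pairing (T xi) eta = pairing xi (S eta)) ->
  contraction_norm S <= contraction_norm T.
Proof.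
move=> TS; apply/contraction_norm_le => eta heta x; set a := S eta x.
rewrite leNgt; apply/negP => lt.
have a0 : a != 0.
  by rewrite -(padic_abs_eq0 R) gt_eqF// (le_lt_trans _ lt)// contraction_norm_ge0.
have pE : pabs (frac p%:R) = p%:R^-1 by rewrite padic_abs_int padic_int_abs_p.
have p0 : frac p%:R != 0.
  by rewrite -(padic_abs_eq0 R) pE invr_eq0 gt_eqF// prime_R_gt0.
have /asboolP[z zE] : frac p%:R * a \in integral.
  apply: padic_integralM; first exact: padic_integral_frac.
  exact: contraction_integral.
have z0 : frac z != 0 by rewrite -zE; exact: (mulf_neq0 p0 a0).
have h : (fun y => if y == x then (frac z)^-1 else 0) \in @almost_integral _ p_pr X.
  apply/asboolP; apply: (sub_finite_set _ (finite_set1 x)) => y /=.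
  by case: eqVneq => //; rewrite rpred0.
pose xi := PadicFun h.
have zxi : z *: xi = delta x.
  apply: padic_funP => y; rewrite padic_funZ /=.
  by case: eqVneq => _; rewrite ?mulr0// divff.
have [lT _ _] := contractionP T.
have Txi y : T xi y \in integral.
  apply/(padic_integralP R).
  suff : pabs (frac z) * pabs (T xi y) <= pabs (frac z) * 1.
    by rewrite ler_pM2l// lt_def padic_abs_ge0 padic_abs_eq0 z0.
  rewrite mulr1 -padic_absM -padic_funZ -linear_opZ// zxi -zE.
  apply: padic_abs_lt; apply: (le_lt_trans _ lt); apply: contraction_norm_ub.
  by move=> w /=; case: ifP => _; rewrite -?tofrac1 -?tofrac0 padic_integral_frac.
have := TS xi eta; rewrite /pairing fsbig1; last first.
  move=> y _; rewrite -[RHS](raddf0 (\pi_(padic_quot p_pr)%qT)).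
  by apply/padic_quotP; rewrite subr0 padic_integralM.
rewrite -(fsbig_widen [set x])//; last first.
  move=> y [_ /= /eqP yx]; rewrite (negPf yx) mul0r.
  exact: (raddf0 (\pi_(padic_quot p_pr)%qT)).
rewrite fsbig_set1 /= eqxx -/a -[LHS](raddf0 (\pi_(padic_quot p_pr)%qT)).
move/padic_quotP; rewrite sub0r rpredN => /(padic_integralP R).
rewrite -zE invfM -mulrA (mulVf a0) mulr1 padic_absV pE invrK leNgt.
by rewrite prime_R_gt1.
Qed.

Lemma adjoint_norm_le T : contraction_norm (adjoint T) <= contraction_norm T.
Proof.
rewrite /adjoint; case: xgetP => [S _ /= /pairing_adjoint_le//|_].
apply/contraction_norm_le => xi _ x.
by rewrite contraction0 padic_fun0 padic_abs0 contraction_norm_ge0.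
Qed.

End Contractions.
End PadicOperators.

Section ModuleTensor.
Variables (K : comNzRingType) (M N : lmodType K).
Local Notation sums := (seq (M * N)).
Implicit Types (s t : sums).

(* The sequence [:: (a_1, b_1); ...; (a_r, b_r)] stands for the formal sum of
   the a_i (x) b_i. *)
Inductive tensor_eq : sums -> sums -> Prop :=
| tensor_eq_sym s t : tensor_eq s t -> tensor_eq t s
| tensor_eq_trans s t u : tensor_eq s t -> tensor_eq t u -> tensor_eq s u
| tensor_eq_perm s t : perm_eq s t -> tensor_eq s t
| tensor_eq_cat s s' t : tensor_eq s s' -> tensor_eq (s ++ t) (s' ++ t)
| tensor_eq_0 b : tensor_eq [:: (0, b)] [::]
| tensor_eq_Dl a a' b : tensor_eq [:: (a + a', b)] [:: (a, b); (a', b)]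
| tensor_eq_Dr a b b' : tensor_eq [:: (a, b + b')] [:: (a, b); (a, b')]
| tensor_eq_Z k a b : tensor_eq [:: (k *: a, b)] [:: (a, k *: b)].

Lemma tensor_eq_refl s : tensor_eq s s.
Proof. exact/tensor_eq_perm/perm_refl. Qed.

Lemma tensor_eq_catr s t t' : tensor_eq t t' -> tensor_eq (s ++ t) (s ++ t').
Proof.
move=> tt'; have c u v : tensor_eq (u ++ v) (v ++ u).
  by apply: tensor_eq_perm; rewrite perm_catC.
exact: tensor_eq_trans (c _ _) (tensor_eq_trans (tensor_eq_cat _ tt') (c _ _)).
Qed.

Lemma tensor_eq_cat2 s s' t t' :
  tensor_eq s s' -> tensor_eq t t' -> tensor_eq (s ++ t) (s' ++ t').
Proof.
by move=> ss' tt'; apply: tensor_eq_trans (tensor_eq_cat _ ss') (tensor_eq_catr _ tt').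
Qed.

Definition tensor_rel : rel sums := fun s t => `[< tensor_eq s t >].

Fact tensor_rel_equiv : equiv_class_of tensor_rel.
Proof.
split=> [s|s t|t s u]; first exact/asboolP/tensor_eq_refl.
  by apply/asboolP/asboolP => /tensor_eq_sym.
by move=> /asboolP st /asboolP tu; apply/asboolP/(tensor_eq_trans st tu).
Qed.

Canonical tensor_equiv := EquivRelPack tensor_rel_equiv.
Canonical tensor_encModRel := defaultEncModRel tensor_rel.

Definition tensor := {eq_quot tensor_rel}%qT.
HB.instance Definition _ := EqQuotient.on tensor.
HB.instance Definition _ := Choice.on tensor.

Definition tensor_class s : tensor := \pi_tensor%qT s.
Local Notation cl := tensor_class.

Lemma tensor_classP s t : cl s = cl t <-> tensor_eq s t.
Proof.
split=> [/eqP|st]; first by rewrite /cl eqmodE => /asboolP.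
by apply/eqP; rewrite /cl eqmodE; apply/asboolP.
Qed.

Lemma tensor_repr s : tensor_eq (repr (cl s)) s.
Proof. by apply/tensor_classP; exact: reprK. Qed.

Lemma tensor_reprK (u : tensor) : cl (repr u) = u.
Proof. exact: reprK. Qed.

Definition tensor_add (u v : tensor) : tensor := cl (repr u ++ repr v).
Definition sums_scale (k : K) s : sums := [seq (k *: ab.1, ab.2) | ab <- s].
Definition tensor_scale k (u : tensor) : tensor := cl (sums_scale k (repr u)).
Definition tensor_opp := tensor_scale (-1).
Definition tensor_zero : tensor := cl [::].

Lemma sums_scale_eq k s t : tensor_eq s t -> tensor_eq (sums_scale k s) (sums_scale k t).
Proof.
elim=> {s t} [s t _|s t u _ IH _|s t st|s s' t _|b|a a' b|a b b'|l a b] /=.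
- exact: tensor_eq_sym.
- exact: tensor_eq_trans.
- exact/tensor_eq_perm/perm_map.
- by rewrite /sums_scale !map_cat; exact: tensor_eq_cat.
- by rewrite scaler0; exact: tensor_eq_0.
- by rewrite scalerDr; exact: tensor_eq_Dl.
- exact: tensor_eq_Dr.
- by rewrite scalerA mulrC -scalerA; exact: tensor_eq_Z.
Qed.

Lemma tensor_addE s t : tensor_add (cl s) (cl t) = cl (s ++ t).
Proof. by apply/tensor_classP/tensor_eq_cat2; exact: tensor_repr. Qed.

Lemma tensor_scaleE k s : tensor_scale k (cl s) = cl (sums_scale k s).
Proof. exact/tensor_classP/sums_scale_eq/tensor_repr. Qed.

Fact tensor_addA : associative tensor_add.
Proof.
move=> u v w; rewrite -[u]tensor_reprK -[v]tensor_reprK -[w]tensor_reprK.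
by rewrite !tensor_addE catA.
Qed.

Fact tensor_addC : commutative tensor_add.
Proof.
move=> u v; rewrite -[u]tensor_reprK -[v]tensor_reprK !tensor_addE.
by apply/tensor_classP/tensor_eq_perm; rewrite perm_catC.
Qed.

Fact tensor_add0 : left_id tensor_zero tensor_add.
Proof. by move=> u; rewrite -[u]tensor_reprK tensor_addE. Qed.

Lemma sums_scaleDl k l s :
  tensor_eq (sums_scale (k + l) s) (sums_scale k s ++ sums_scale l s).
Proof.
elim: s => [|[a b] s IH] /=; first exact: tensor_eq_refl.
rewrite scalerDl -cat1s.
apply: (tensor_eq_trans (tensor_eq_cat2 (tensor_eq_Dl _ _ _) IH)).
by apply: tensor_eq_perm; rewrite /= perm_cons -cat1s perm_catCA.
Qed.

Lemma sums_scale0 s : tensor_eq (sums_scale 0 s) [::].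
Proof.
elim: s => [|[a b] s IH] /=; first exact: tensor_eq_refl.
by rewrite scale0r -cat1s; apply: (tensor_eq_cat2 (tensor_eq_0 _) IH).
Qed.

Lemma sums_scale1 s : sums_scale 1 s = s.
Proof. by elim: s => [|[a b] s IH] //=; rewrite scale1r IH. Qed.

Fact tensor_addN : left_inverse tensor_zero tensor_opp tensor_add.
Proof.
move=> u; rewrite -[u]tensor_reprK /tensor_opp tensor_scaleE tensor_addE.
apply/tensor_classP; rewrite -[X in _ ++ X]sums_scale1.
apply: (tensor_eq_trans (tensor_eq_sym (sums_scaleDl _ _ _))).
by rewrite addNr; exact: sums_scale0.
Qed.

HB.instance Definition _ :=
  GRing.isZmodule.Build tensor tensor_addA tensor_addC tensor_add0 tensor_addN.

Fact tensor_scaleA k l u : tensor_scale k (tensor_scale l u) = tensor_scale (k * l) u.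
Proof.
rewrite -[u]tensor_reprK !tensor_scaleE /sums_scale -map_comp.
by congr cl; apply: eq_map => -[a b] /=; rewrite scalerA.
Qed.

Fact tensor_scale1 : left_id 1 tensor_scale.
Proof. by move=> u; rewrite -[u]tensor_reprK tensor_scaleE sums_scale1. Qed.

Fact tensor_scaleDr : right_distributive tensor_scale +%R.
Proof.
move=> k u v; rewrite -[u]tensor_reprK -[v]tensor_reprK.
by rewrite [_ + _]tensor_addE !tensor_scaleE [_ + _]tensor_addE /sums_scale map_cat.
Qed.

Fact tensor_scaleDl u : {morph tensor_scale^~ u : k l / k + l}.
Proof.
move=> k l; rewrite -[u]tensor_reprK !tensor_scaleE [RHS]tensor_addE.
exact/tensor_classP/sums_scaleDl.
Qed.

HB.instance Definition _ := GRing.Zmodule_isLmodule.Build K tensor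
  tensor_scaleA tensor_scale1 tensor_scaleDr tensor_scaleDl.

Lemma tensor_class_cat s t : cl (s ++ t) = cl s + cl t.
Proof. by rewrite -[LHS]tensor_addE. Qed.

Definition pure (a : M) (b : N) : tensor := cl [:: (a, b)].

Lemma tensorE s : cl s = \sum_(ab <- s) pure ab.1 ab.2.
Proof.
elim: s => [|[a b] s IH]; first by rewrite big_nil.
by rewrite big_cons -IH -cat1s -[LHS]tensor_addE.
Qed.

Lemma tensor_sum (u : tensor) : u = \sum_(ab <- repr u) pure ab.1 ab.2.
Proof. by rewrite -tensorE tensor_reprK. Qed.

Lemma pure_linl b : linear (pure^~ b).
Proof.
move=> k a a'; rewrite [X in _ = X + _]tensor_scaleE [RHS]tensor_addE.
exact/tensor_classP/tensor_eq_Dl.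
Qed.

Lemma pureZ k a b : pure a (k *: b) = k *: pure a b.
Proof.
by rewrite [RHS]tensor_scaleE; apply/tensor_classP/tensor_eq_sym/tensor_eq_Z.
Qed.

Lemma pure_linr a : linear (pure a).
Proof.
move=> k b b'; rewrite -pureZ [RHS]tensor_addE.
exact/tensor_classP/tensor_eq_Dr.
Qed.

Lemma tensor_ind (P : tensor -> Prop) : P 0 -> (forall u v, P u -> P v -> P (u + v)) ->
  (forall a b, P (pure a b)) -> forall u, P u.
Proof.
move=> P0 PD Pp u; rewrite [u]tensor_sum.
by elim/big_rec: _ => // ab v _ Pv; exact: PD.
Qed.

(* The linear map a (x) b |-> f a b, for f bilinear. *)
Definition tensor_lift (W : lmodType K) (f : M -> N -> W) (u : tensor) : W :=
  \sum_(ab <- repr u) f ab.1 ab.2.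

Section Lift.
Variables (W : lmodType K) (f : M -> N -> W).
Hypotheses (fl : forall b, linear (f^~ b)) (fr : forall a, linear (f a)).

Let sum_eq s t : tensor_eq s t ->
  \sum_(ab <- s) f ab.1 ab.2 = \sum_(ab <- t) f ab.1 ab.2.
Proof.
elim=> {s t} [s t _|s t u _ IH _|s t st|s s' t _ IH|b|a a' b|a b b'|l a b] /=.
- by move->.
- by rewrite IH.
- exact: perm_big.
- by rewrite !big_cat IH.
- rewrite big_seq1 big_nil /=.
  by have := fl b (-1) 0 0; rewrite scaler0 addr0 scaleN1r addNr.
- by rewrite big_seq1 big_cons big_seq1 /=; have := fl b 1 a a'; rewrite !scale1r.
- by rewrite big_seq1 big_cons big_seq1 /=; have := fr a 1 b b'; rewrite !scale1r.
- rewrite !big_seq1 /=.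
  have f0l b' : f 0 b' = 0.
    by have := fl b' (-1) 0 0; rewrite scaler0 addr0 scaleN1r addNr.
  have fr0 a' : f a' 0 = 0.
    by have := fr a' (-1) 0 0; rewrite scaler0 addr0 scaleN1r addNr.
  have := fl b l a 0; rewrite addr0 f0l addr0 => ->.
  by have := fr a l b 0; rewrite addr0 fr0 addr0 => ->.
Qed.

Lemma tensor_lift_class s : tensor_lift f (cl s) = \sum_(ab <- s) f ab.1 ab.2.
Proof. exact/sum_eq/tensor_repr. Qed.

Lemma tensor_lift_pure a b : tensor_lift f (pure a b) = f a b.
Proof. by rewrite tensor_lift_class big_seq1. Qed.

Lemma tensor_lift_linear : linear (tensor_lift f).
Proof.
move=> k u v; rewrite -[u]tensor_reprK -[v]tensor_reprK.
rewrite [X in tensor_lift _ (X + _)]tensor_scaleE [X in tensor_lift _ X]tensor_addE.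
rewrite !tensor_lift_class big_cat big_map scaler_sumr; congr (_ + _).
apply: eq_bigr => -[a b] _ /=.
have f0l b' : f 0 b' = 0.
  by have := fl b' (-1) 0 0; rewrite scaler0 addr0 scaleN1r addNr.
by have := fl b k a 0; rewrite addr0 f0l addr0.
Qed.

End Lift.
End ModuleTensor.

Section StarAlgebra.
Variables (p : nat) (p_pr : prime p).
Local Notation Zp := (padic_int p_pr).

(* Not necessarily unital. *)
Record star_algebra := StarAlgebra {
  sa_module :> lmodType Zp;
  sa_mul : sa_module -> sa_module -> sa_module;
  sa_star : sa_module -> sa_module;
  sa_mulA : associative sa_mul;
  sa_mul_linl : forall b, linear (sa_mul^~ b);
  sa_mul_linr : forall a, linear (sa_mul a);
  sa_star_linear : linear sa_star;
  sa_starM : forall a b, sa_star (sa_mul a b) = sa_mul (sa_star b) (sa_star a);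
  sa_starK : involutive sa_star }.

Lemma linear_fun0 (U V : lmodType Zp) (f : U -> V) : linear f -> f 0 = 0.
Proof. by move=> /(_ (-1) 0 0); rewrite scaler0 addr0 scaleN1r addNr. Qed.

Lemma linear_funD (U V : lmodType Zp) (f : U -> V) :
  linear f -> {morph f : x y / x + y}.
Proof. by move=> lf x y; rewrite -[x in LHS]scale1r lf scale1r. Qed.

Lemma linear_funZ (U V : lmodType Zp) (f : U -> V) :
  linear f -> forall k x, f (k *: x) = k *: f x.
Proof. by move=> lf k x; rewrite -[_ *: x in LHS]addr0 lf linear_fun0// addr0. Qed.

Lemma linear_funB (U V : lmodType Zp) (f : U -> V) :
  linear f -> {morph f : x y / x - y}.
Proof.
by move=> lf x y; rewrite linear_funD// -scaleN1r linear_funZ// scaleN1r.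
Qed.

Section Tensor.
Variables A B : star_algebra.
Local Notation AB := (tensor A B).

Let mul1 (a : A) (b : B) : AB -> AB :=
  tensor_lift (fun a' b' => pure (sa_mul a a') (sa_mul b b')).

Let mul1_bil a b :
  (forall b', linear (fun a' => pure (sa_mul a a') (sa_mul b b') : AB)) /\
  (forall a', linear (fun b' => pure (sa_mul a a') (sa_mul b b') : AB)).
Proof.
split=> [b' k x y|a' k x y]; first by rewrite sa_mul_linr pure_linl.
by rewrite sa_mul_linr pure_linr.
Qed.

Definition tensor_mul (u v : AB) : AB := tensor_lift (fun a b => mul1 a b v) u.

Definition tensor_star : AB -> AB :=
  tensor_lift (fun a b => pure (sa_star a) (sa_star b)).

Let mul1_pure a b a' b' : mul1 a b (pure a' b') = pure (sa_mul a a') (sa_mul b b').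
Proof. by have [? ?] := mul1_bil a b; rewrite /mul1 tensor_lift_pure. Qed.

Let mul1_linear a b : linear (mul1 a b).
Proof. by have [? ?] := mul1_bil a b; exact: tensor_lift_linear. Qed.

Let mul1_linl b v : linear (fun a => mul1 a b v).
Proof.
move=> k a a'; elim/tensor_ind: v => [|u v IHu IHv|x y].
- by rewrite !(linear_fun0 (mul1_linear _ _)) scaler0 addr0.
- rewrite !(linear_funD (mul1_linear _ _)) IHu IHv scalerDr.
  by rewrite addrACA.
- by rewrite !mul1_pure sa_mul_linl pure_linl.
Qed.

Let mul1_linr a v : linear (fun b => mul1 a b v).
Proof.
move=> k b b'; elim/tensor_ind: v => [|u v IHu IHv|x y].
- by rewrite !(linear_fun0 (mul1_linear _ _)) scaler0 addr0.
- rewrite !(linear_funD (mul1_linear _ _)) IHu IHv scalerDr.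
  by rewrite addrACA.
- by rewrite !mul1_pure sa_mul_linl pure_linr.
Qed.

Lemma tensor_mul_pure a b a' b' :
  tensor_mul (pure a b) (pure a' b') = pure (sa_mul a a') (sa_mul b b').
Proof.
by rewrite /tensor_mul tensor_lift_pure ?mul1_pure.
Qed.

Lemma tensor_mul_linl v : linear (tensor_mul^~ v).
Proof. by apply: tensor_lift_linear => [b|a]; [exact: mul1_linl|exact: mul1_linr]. Qed.

Lemma tensor_mul_linr u : linear (tensor_mul u).
Proof.
move=> k v w; rewrite /tensor_mul /tensor_lift scaler_sumr -big_split /=.
by apply: eq_bigr => ab _; exact: mul1_linear.
Qed.

Lemma tensor_star_pure a b : tensor_star (pure a b) = pure (sa_star a) (sa_star b).
Proof.
rewrite /tensor_star tensor_lift_pure// => [b' k x y|a' k x y].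
  by rewrite sa_star_linear pure_linl.
by rewrite sa_star_linear pure_linr.
Qed.

Lemma tensor_star_linear : linear tensor_star.
Proof.
apply: tensor_lift_linear => [b' k x y|a' k x y].
  by rewrite sa_star_linear pure_linl.
by rewrite sa_star_linear pure_linr.
Qed.

Let mulDl u v w : tensor_mul (u + v) w = tensor_mul u w + tensor_mul v w.
Proof. exact: (linear_funD (tensor_mul_linl w)). Qed.
Let mulDr u v w : tensor_mul w (u + v) = tensor_mul w u + tensor_mul w v.
Proof. exact: (linear_funD (tensor_mul_linr w)). Qed.
Let mul0 w : tensor_mul 0 w = 0.
Proof. exact: (linear_fun0 (tensor_mul_linl w)). Qed.
Let mulr0 w : tensor_mul w 0 = 0.
Proof. exact: (linear_fun0 (tensor_mul_linr w)). Qed.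
Let starD u v : tensor_star (u + v) = tensor_star u + tensor_star v.
Proof. exact: (linear_funD tensor_star_linear). Qed.
Let star0 : tensor_star 0 = 0.
Proof. exact: (linear_fun0 tensor_star_linear). Qed.

Fact tensor_mulA : associative tensor_mul.
Proof.
move=> u v w.
elim/tensor_ind: u => [|u u' IH IH'|a b]; first by rewrite !mul0.
  by rewrite !mulDl IH IH'.
elim/tensor_ind: v => [|u u' IH IH'|a' b']; first by rewrite !(mul0, mulr0).
  by rewrite !(mulDl, mulDr) IH IH'.
elim/tensor_ind: w => [|u u' IH IH'|a'' b'']; first by rewrite !mulr0.
  by rewrite !mulDr IH IH'.
by rewrite !tensor_mul_pure !sa_mulA.
Qed.

Fact tensor_starM u v :
  tensor_star (tensor_mul u v) = tensor_mul (tensor_star v) (tensor_star u).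
Proof.
elim/tensor_ind: u => [|u u' IH IH'|a b]; first by rewrite !(mul0, star0, mulr0).
  by rewrite mulDl !starD IH IH' mulDr.
elim/tensor_ind: v => [|u u' IH IH'|a' b']; first by rewrite !(mul0, star0, mulr0).
  by rewrite mulDr !starD IH IH' mulDl.
by rewrite !(tensor_mul_pure, tensor_star_pure) !sa_starM.
Qed.

Fact tensor_starK : involutive tensor_star.
Proof.
move=> u; elim/tensor_ind: u => [|u u' IH IH'|a b]; first by rewrite !star0.
  by rewrite !starD IH IH'.
by rewrite !tensor_star_pure !sa_starK.
Qed.

Definition tensor_algebra : star_algebra :=
  @StarAlgebra AB tensor_mul tensor_star tensor_mulA tensor_mul_linl
    tensor_mul_linr tensor_star_linear tensor_starM tensor_starK.

End Tensor.

Variable R : realType.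

Record star_seminorm (C : star_algebra) (N : C -> R) : Prop := StarSeminorm {
  sn_ge0 : forall x, 0 <= N x;
  sn_ultra : forall x y, N (x + y) <= Num.max (N x) (N y);
  sn_scale : forall k x, N (k *: x) <= padic_int_abs R k * N x;
  sn_mul : forall x y, N (sa_mul x y) <= N x * N y;
  sn_star : forall x, N (sa_star x) <= N x }.

Record seminormed_algebra := SeminormedAlgebra {
  sna_algebra :> star_algebra;
  sna_norm : sna_algebra -> R;
  sna_seminorm : star_seminorm sna_norm }.

Section Completion.
Variable C : seminormed_algebra.
Local Notation N := (@sna_norm C).
Local Notation "x ** y" := (@sa_mul C x y) (at level 40).
Local Notation star := (@sa_star C).

Let N_ge0 x : 0 <= N x. Proof. exact/sn_ge0/sna_seminorm. Qed.
Let N_ultra x y : N (x + y) <= Num.max (N x) (N y).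
Proof. exact/sn_ultra/sna_seminorm. Qed.
Let N_mul x y : N (x ** y) <= N x * N y. Proof. exact/sn_mul/sna_seminorm. Qed.
Let N_star x : N (star x) <= N x. Proof. exact/sn_star/sna_seminorm. Qed.
Let N_scale k x : N (k *: x) <= padic_int_abs R k * N x.
Proof. exact/sn_scale/sna_seminorm. Qed.

Let N_scale_le k x : N (k *: x) <= N x.
Proof.
by apply: (le_trans (N_scale _ _)); rewrite ler_piMl// padic_int_abs_le1.
Qed.

Let N0 : N 0 = 0.
Proof.
apply/eqP; rewrite eq_le N_ge0 andbT -[0 in leLHS](scale0r (0 : C)).
by apply: (le_trans (N_scale _ _)); rewrite padic_int_abs0 mul0r.
Qed.

Let NN x : N (- x) = N x.
Proof.
have le y : N (- y) <= N y by rewrite -scaleN1r N_scale_le.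
by apply/eqP; rewrite eq_le le -{1}[x]opprK le.
Qed.

Let N_dist x y : `|N x - N y| <= N (x - y).
Proof.
have h u v : N u <= N v + N (u - v).
  rewrite -{1}(subrK v u); apply: (le_trans (N_ultra _ _)).
  by rewrite ge_max lerDr lerDl !N_ge0.
rewrite ler_norml; apply/andP; split.
  by rewrite lerNl opprB lerBlDl -(NN (x - y)) opprB h.
by rewrite lerBlDl h.
Qed.

Definition cauchy_seq : {pred nat -> C} := fun x => `[< forall e : R, 0 < e ->
  exists n, forall i j, (n <= i)%N -> (n <= j)%N -> N (x i - x j) < e >].

Fact cauchy_submod_closed : submod_closed cauchy_seq.
Proof.
split=> [|k x y /asboolP cx /asboolP cy]; apply/asboolP => e e0.
  by exists 0%N => i j _ _; rewrite subr0 N0.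
have [n hn] := cx e e0; have [m hm] := cy e e0.
exists (maxn n m) => i j; rewrite !geq_max => /andP[ni mi] /andP[nj mj].
have -> : (k *: x + y) i - (k *: x + y) j = k *: (x i - x j) + (y i - y j).
  change (k *: x i + y i - (k *: x j + y j) = k *: (x i - x j) + (y i - y j)).
  by rewrite scalerBr opprD addrACA.
apply: (le_lt_trans (N_ultra _ _)); rewrite gt_max hm// andbT.
by apply: (le_lt_trans (N_scale_le _ _)); exact: hn.
Qed.

HB.instance Definition _ := GRing.isSubmodClosed.Build Zp (nat -> C)
  cauchy_seq cauchy_submod_closed.

Record cauchy := Cauchy {
  cauchy_val :> nat -> C;
  _ : cauchy_val \in cauchy_seq }.

HB.instance Definition _ := [isSub for cauchy_val].
HB.instance Definition _ := [Choice of cauchy by <:].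
HB.instance Definition _ := [SubChoice_isSubLmodule of cauchy by <:].

Implicit Types x y z : cauchy.

Lemma cauchyP x (e : R) : 0 < e ->
  exists n, forall i j, (n <= i)%N -> (n <= j)%N -> N (x i - x j) < e.
Proof. by case: x => f /= /asboolP; apply. Qed.

Lemma cauchy_eqP x y : (forall n, x n = y n) -> x = y.
Proof. by move=> h; apply/val_inj/funext => n; exact: h. Qed.

Lemma cauchy_bounded x : exists2 M : R, 0 < M &
  exists n, forall i, (n <= i)%N -> N (x i) <= M.
Proof.
have [n hn] := cauchyP x ltr01.
exists (Num.max 1 (N (x n))); first by rewrite lt_max ltr01.
exists n => i ni; rewrite -{1}(subrK (x n) (x i)); apply: (le_trans (N_ultra _ _)).
by rewrite ge_max !le_max lexx orbT andbT (ltW (hn _ _ ni (leqnn _))).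
Qed.

Definition null_seq : {pred cauchy} := fun x => `[< forall e : R, 0 < e ->
  exists n, forall i, (n <= i)%N -> N (x i) < e >].

Lemma null_seqZD k x y : x \in null_seq -> y \in null_seq -> k *: x + y \in null_seq.
Proof.
move=> /asboolP cx /asboolP cy; apply/asboolP => e e0.
have [n hn] := cx e e0; have [m hm] := cy e e0.
exists (maxn n m) => i; rewrite !geq_max => /andP[ni mi].
apply: (le_lt_trans (N_ultra _ _)); rewrite gt_max hm// andbT.
by apply: (le_lt_trans (N_scale_le _ _)); exact: hn.
Qed.

Lemma null_seq0 : 0 \in null_seq.
Proof. by apply/asboolP => e e0; exists 0%N => i _; rewrite N0. Qed.

Fact null_zmod_closed : zmod_closed null_seq.
Proof.
split=> [|x y hx hy]; first exact: null_seq0.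
by rewrite addrC -scaleN1r; exact: null_seqZD.
Qed.

HB.instance Definition _ := GRing.isZmodClosed.Build cauchy null_seq null_zmod_closed.

Definition completion_carrier := Quotient.quot null_seq.
HB.instance Definition _ := GRing.Zmodule.on completion_carrier.
Local Notation Q := completion_carrier.

Definition comp_class x : Q := \pi_(Q)%qT x.
Definition comp_repr (u : Q) : cauchy := repr u.

Lemma comp_reprK u : comp_class (comp_repr u) = u. Proof. exact: reprK. Qed.

Lemma comp_classP x y : comp_class x = comp_class y <-> x - y \in null_seq.
Proof. by rewrite Quotient.idealrBE; split=> /eqP. Qed.

Lemma comp_reprP x : comp_repr (comp_class x) - x \in null_seq. Proof. by apply/comp_classP; rewrite comp_reprK. Qed.

Lemma comp_classD x y : comp_class (x + y) = comp_class x + comp_class y. Proof. exact: raddfD. Qed.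

Lemma null_seqZ k x : x \in null_seq -> k *: x \in null_seq.
Proof. by move=> nx; rewrite -[_ *: x]addr0 null_seqZD// null_seq0. Qed.

Definition comp_scale k (u : Q) : Q := comp_class (k *: comp_repr u).

Lemma comp_scaleE k x : comp_scale k (comp_class x) = comp_class (k *: x).
Proof. by apply/comp_classP; rewrite -scalerBr null_seqZ// comp_reprP. Qed.

Fact comp_scaleA k l u : comp_scale k (comp_scale l u) = comp_scale (k * l) u.
Proof. by rewrite -[u]comp_reprK !comp_scaleE scalerA. Qed.

Fact comp_scale1 : left_id 1 comp_scale.
Proof. by move=> u; rewrite -[u]comp_reprK comp_scaleE scale1r. Qed.

Fact comp_scaleDr : right_distributive comp_scale +%R.
Proof.
by move=> k u v; rewrite -[u]comp_reprK -[v]comp_reprK -comp_classD !comp_scaleE -comp_classD scalerDr.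
Qed.

Fact comp_scaleDl u : {morph comp_scale^~ u : k l / k + l}.
Proof. by move=> k l; rewrite -[u]comp_reprK !comp_scaleE -comp_classD scalerDl. Qed.

HB.instance Definition _ := GRing.Zmodule_isLmodule.Build Zp Q
  comp_scaleA comp_scale1 comp_scaleDr comp_scaleDl.

Lemma comp_classZD k x y : comp_class (k *: x + y) = k *: comp_class x + comp_class y.
Proof. by rewrite comp_classD [RHS](congr1 (+%R^~ _) (comp_scaleE k x)). Qed.

Fact cauchy_mul_subproof x y : (fun n => x n ** y n) \in cauchy_seq.
Proof.
apply/asboolP => e e0.
have [M M0 [n hn]] := cauchy_bounded x; have [L L0 [m hm]] := cauchy_bounded y.
have [n' hn'] := cauchyP x (divr_gt0 e0 L0).
have [m' hm'] := cauchyP y (divr_gt0 e0 M0).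
exists (maxn (maxn n n') (maxn m m')) => i j.
rewrite !geq_max -!andbA => /and4P[ni n'i mi m'i] /and4P[nj n'j mj m'j].
have -> : x i ** y i - x j ** y j = x i ** (y i - y j) + (x i - x j) ** y j.
  rewrite (linear_funB (sa_mul_linr (x i))).
  by rewrite (linear_funB (sa_mul_linl (y j))) addrA subrK.
apply: (le_lt_trans (N_ultra _ _)); rewrite gt_max; apply/andP; split.
  apply: (le_lt_trans (N_mul _ _)).
  apply: (le_lt_trans (ler_wpM2r (N_ge0 _) (hn _ ni))).
  by rewrite mulrC -ltr_pdivlMr// hm'.
apply: (le_lt_trans (N_mul _ _)).
apply: (le_lt_trans (ler_wpM2l (N_ge0 _) (hm _ mj))).
by rewrite -ltr_pdivlMr// hn'.
Qed.

Definition cauchy_mul x y := Cauchy (cauchy_mul_subproof x y).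

Lemma null_seq_mull x y : x \in null_seq -> cauchy_mul x y \in null_seq.
Proof.
move=> /asboolP nx; apply/asboolP => e e0.
have [L L0 [m hm]] := cauchy_bounded y; have [n hn] := nx _ (divr_gt0 e0 L0).
exists (maxn n m) => i; rewrite geq_max => /andP[ni mi].
apply: (le_lt_trans (N_mul _ _)).
apply: (le_lt_trans (ler_wpM2l (N_ge0 _) (hm _ mi))).
by rewrite -ltr_pdivlMr// hn.
Qed.

Lemma null_seq_mulr x y : y \in null_seq -> cauchy_mul x y \in null_seq.
Proof.
move=> /asboolP ny; apply/asboolP => e e0.
have [L L0 [m hm]] := cauchy_bounded x; have [n hn] := ny _ (divr_gt0 e0 L0).
exists (maxn n m) => i; rewrite geq_max => /andP[ni mi].
apply: (le_lt_trans (N_mul _ _)).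
apply: (le_lt_trans (ler_wpM2r (N_ge0 _) (hm _ mi))).
by rewrite mulrC -ltr_pdivlMr// hn.
Qed.

Lemma cauchy_mul_linl y : linear (cauchy_mul^~ y).
Proof. by move=> k x z; apply: cauchy_eqP => n; exact: (sa_mul_linl (y n)). Qed.

Lemma cauchy_mul_linr x : linear (cauchy_mul x).
Proof. by move=> k y z; apply: cauchy_eqP => n; exact: (sa_mul_linr (x n)). Qed.

Definition comp_mul (u v : Q) : Q := comp_class (cauchy_mul (comp_repr u) (comp_repr v)).

Lemma comp_mulE x y : comp_mul (comp_class x) (comp_class y) = comp_class (cauchy_mul x y).
Proof.
apply/comp_classP; set x' := comp_repr _; set y' := comp_repr _.
have -> : cauchy_mul x' y' - cauchy_mul x y =
    cauchy_mul x' (y' - y) + cauchy_mul (x' - x) y.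
  rewrite (linear_funB (cauchy_mul_linr x')).
  by rewrite (linear_funB (cauchy_mul_linl y)) addrA subrK.
by apply: rpredD; [apply: null_seq_mulr|apply: null_seq_mull]; exact: comp_reprP.
Qed.

Fact cauchy_star_subproof x : (fun n => star (x n)) \in cauchy_seq.
Proof.
apply/asboolP => e /(cauchyP x)[n hn]; exists n => i j ni nj.
rewrite -(linear_funB (@sa_star_linear C)).
by apply: (le_lt_trans (N_star _)); exact: hn.
Qed.

Definition cauchy_star x := Cauchy (cauchy_star_subproof x).

Lemma cauchy_star_linear : linear cauchy_star.
Proof. by move=> k x z; apply: cauchy_eqP => n; exact: sa_star_linear. Qed.

Definition comp_star (u : Q) : Q := comp_class (cauchy_star (comp_repr u)).

Lemma comp_starE x : comp_star (comp_class x) = comp_class (cauchy_star x).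
Proof.
apply/comp_classP; rewrite -(linear_funB cauchy_star_linear).
have /asboolP nx := comp_reprP x.
apply/asboolP => e /nx[n hn]; exists n => i ni.
by apply: (le_lt_trans (N_star _)); exact: hn.
Qed.

Fact comp_mulA : associative comp_mul.
Proof.
move=> u v w; rewrite -[u]comp_reprK -[v]comp_reprK -[w]comp_reprK !comp_mulE; congr comp_class.
by apply: cauchy_eqP => n; exact: sa_mulA.
Qed.

Fact comp_mul_linl v : linear (comp_mul^~ v).
Proof.
move=> k u w; rewrite -[u]comp_reprK -[v]comp_reprK -[w]comp_reprK -comp_classZD !comp_mulE -comp_classZD.
by rewrite cauchy_mul_linl.
Qed.

Fact comp_mul_linr v : linear (comp_mul v).
Proof.
move=> k u w; rewrite -[u]comp_reprK -[v]comp_reprK -[w]comp_reprK -comp_classZD !comp_mulE -comp_classZD.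
by rewrite cauchy_mul_linr.
Qed.

Fact comp_star_linear : linear comp_star.
Proof.
move=> k u w; rewrite -[u]comp_reprK -[w]comp_reprK -comp_classZD !comp_starE -comp_classZD.
by rewrite cauchy_star_linear.
Qed.

Fact comp_starM u v : comp_star (comp_mul u v) = comp_mul (comp_star v) (comp_star u).
Proof.
rewrite -[u]comp_reprK -[v]comp_reprK comp_mulE 3!comp_starE comp_mulE; congr comp_class.
by apply: cauchy_eqP => n; exact: sa_starM.
Qed.

Fact comp_starK : involutive comp_star.
Proof.
move=> u; rewrite -[u]comp_reprK !comp_starE; congr comp_class.
by apply: cauchy_eqP => n; exact: sa_starK.
Qed.

Definition completion_algebra : star_algebra :=
  @StarAlgebra Q comp_mul comp_star comp_mulA comp_mul_linl comp_mul_linr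
    comp_star_linear comp_starM comp_starK.

Definition comp_norm (u : Q) : R := limn (fun n => N (comp_repr u n)).

Lemma cauchy_norm_cvg x : cvgn (fun n => N (x n)).
Proof.
apply/cauchy_cvgP/cauchy_exP => e e0; have [n hn] := cauchyP x e0.
exists (N (x n)); exists n => // i /= ni; rewrite /ball /=.
by apply: (le_lt_trans (N_dist _ _)); exact: hn.
Qed.

Lemma comp_normE x : N (x n) @[n --> \oo] --> comp_norm (comp_class x).
Proof.
have h := @cauchy_norm_cvg (comp_repr (comp_class x)).
rewrite -[X in _ --> X]addr0.
rewrite (_ : (fun n => N (x n)) =
  (fun n => N (comp_repr (comp_class x) n) + (N (x n) - N (comp_repr (comp_class x) n)))); last first.
  by apply/funext => n; rewrite addrC subrK.
apply: cvgD => //; apply/cvgr0Pnorm_lt => e e0.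
have /asboolP/(_ e e0)[n hn] := comp_reprP x.
exists n => // i /= ni; apply: (le_lt_trans (N_dist _ _)).
by rewrite -NN opprB; exact: hn.
Qed.

Let le_limits (f g : nat -> R) (l l' : R) : (forall n, f n <= g n) ->
  f n @[n --> \oo] --> l -> g n @[n --> \oo] --> l' -> l <= l'.
Proof. by move=> fg fl gl; apply: (ler_cvg_to fl gl); exact: nearW. Qed.

Lemma comp_norm_ge0 u : 0 <= comp_norm u.
Proof.
rewrite -[u]comp_reprK; apply: (@le_limits (fun=> 0) _ _ _ _ _ (@comp_normE (comp_repr u))) => //.
exact: cvg_cst.
Qed.

Fact comp_seminorm : @star_seminorm completion_algebra comp_norm.
Proof.
split=> [u|u v|k u|u v|u]; first exact: comp_norm_ge0.
- rewrite -[u]comp_reprK -[v]comp_reprK -comp_classD maxr_absE.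
  apply: (le_limits _ (@comp_normE (comp_repr u + comp_repr v))); last first.
    apply: cvgMl; apply: cvgD.
      by apply: cvgD; exact: comp_normE.
    by apply: cvg_norm; apply: cvgB; exact: comp_normE.
  by move=> n; apply: (le_trans (N_ultra _ _)); rewrite maxr_absE.
- rewrite -[u]comp_reprK [_ *: _]comp_scaleE.
  apply: (le_limits _ (@comp_normE (k *: comp_repr u))); last first.
    by apply: cvgMr; exact: comp_normE.
  by move=> n; exact: N_scale.
- rewrite -[u]comp_reprK -[v]comp_reprK [sa_mul _ _]comp_mulE.
  apply: (le_limits _ (@comp_normE (cauchy_mul (comp_repr u) (comp_repr v)))); last first.
    by apply: cvgM; exact: comp_normE.
  by move=> n; exact: N_mul.
- rewrite -[u]comp_reprK [sa_star _]comp_starE.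
  apply: (le_limits _ (@comp_normE (cauchy_star (comp_repr u)))); last exact: comp_normE.
  by move=> n; exact: N_star.
Qed.

Definition completion : seminormed_algebra := SeminormedAlgebra comp_seminorm.

End Completion.
End StarAlgebra.

Section OperatorAlgebras.
Variables (R : realType) (p : nat) (p_pr : prime p).
Local Notation Zp := (padic_int p_pr).
Local Notation Qp := (padic_num p_pr).
Local Notation B X := (contraction R p_pr X).
Local Notation algebra := (seminormed_algebra p_pr R).

Definition star_hom (C : star_algebra p_pr) (X : pointedType) (f : C -> B X) :=
  [/\ linear f,
      forall a b, f (sa_mul a b) = contraction_mul (f a) (f b) &
      forall a, f (sa_star a) = adjoint (f a)].

Definition isometric_star_hom (A : algebra) (X : pointedType) (f : A -> B X) :=
  star_hom f /\ forall a, contraction_norm (f a) = sna_norm a.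

Definition star_isometry (A A' : algebra) (f : A -> A') :=
  [/\ linear f,
      forall a b, f (sa_mul a b) = sa_mul (f a) (f b),
      forall a, f (sa_star a) = sa_star (f a),
      forall a, sna_norm (f a) = sna_norm a &
      bijective f].

Definition norm_closure (X : pointedType) (S : set (B X)) : set (B X) :=
  [set T | forall e : R, 0 < e -> exists2 T', S T' & contraction_norm (T - T') < e].

(* The inequalities required of a seminormed_algebra are not a restriction here:
   they follow from the axioms of a Banach algebra and from poa_embedding. *)
Record padic_operator_algebra := PadicOperatorAlgebra {
  poa_algebra :> algebra;
  poa_definite : forall x : poa_algebra, sna_norm x = 0 -> x = 0;
  poa_homogeneous : forall (k : Zp) (x : poa_algebra),
    sna_norm (k *: x) = padic_int_abs R k * sna_norm x;
  poa_complete : forall x : nat -> poa_algebra,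
    (forall e : R, 0 < e -> exists n, forall i j, (n <= i)%N -> (n <= j)%N ->
      sna_norm (x i - x j) < e) ->
    exists l, forall e : R, 0 < e -> exists n, forall i, (n <= i)%N ->
      sna_norm (x i - l) < e;
  poa_embedding : exists (X : pointedType) (f : poa_algebra -> B X),
    isometric_star_hom f /\ norm_closure (range f) `<=` range f }.

Section Enveloping.
Variable C : star_algebra p_pr.

Definition u_norm (c : C) : R := sup [set r | exists (Z : pointedType)
  (sigma : C -> B Z), star_hom sigma /\ r = contraction_norm (sigma c)].

Let u_norm_ub c (Z : pointedType) (sigma : C -> B Z) : star_hom sigma ->
  contraction_norm (sigma c) <= u_norm c.
Proof.
move=> hs; apply: ub_le_sup; last by exists Z, sigma.
by exists 1 => _ [Z' [s [_ ->]]]; exact: contraction_norm_le1.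
Qed.

Let u_norm_le c r : 0 <= r -> (forall (Z : pointedType) (sigma : C -> B Z),
  star_hom sigma -> contraction_norm (sigma c) <= r) -> u_norm c <= r.
Proof.
move=> r0 h; rewrite /u_norm; set S := [set _ | _].
have [->|/set0P S0] := eqVneq S set0; first by rewrite sup0.
by apply: ge_sup => // _ [Z [s [hs ->]]]; exact: h.
Qed.

Let u_norm_ge0 c : 0 <= u_norm c.
Proof.
have [S0|/set0P[_ [Z [s [hs _]]]]] := eqVneq [set r | exists (Z : pointedType)
  (sigma : C -> B Z), star_hom sigma /\ r = contraction_norm (sigma c)] set0.
  by rewrite /u_norm S0 sup0.
exact: (le_trans (contraction_norm_ge0 (s c)) (u_norm_ub c hs)).
Qed.

Fact u_seminorm : star_seminorm u_norm.
Proof.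
split=> [//|x y|k x|x y|x].
- apply: u_norm_le => [|Z s hs]; first by rewrite le_max u_norm_ge0.
  have [ls _ _] := hs; rewrite (linear_funD ls).
  apply: (le_trans (contraction_normD _ _)).
  by rewrite ge_max !le_max !(u_norm_ub _ hs) ?orbT.
- apply: u_norm_le => [|Z s hs]; first by rewrite mulr_ge0 ?padic_int_abs_ge0.
  have [ls _ _] := hs; rewrite (linear_funZ ls).
  apply: (le_trans (contraction_normZ _ _)).
  by rewrite ler_wpM2l ?padic_int_abs_ge0 ?(u_norm_ub _ hs).
- apply: u_norm_le => [|Z s hs]; first by rewrite mulr_ge0.
  have [_ ms _] := hs; rewrite ms.
  apply: (le_trans (contraction_normM _ _)).
  by rewrite ler_pM ?contraction_norm_ge0 ?(u_norm_ub _ hs).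
- apply: u_norm_le => // Z s hs; have [_ _ ->] := hs.
  by apply: (le_trans (adjoint_norm_le _)); exact: u_norm_ub.
Qed.

Definition enveloping_algebra : algebra := completion (SeminormedAlgebra u_seminorm).

End Enveloping.

Definition max_tensor (A A' : star_algebra p_pr) : algebra :=
  enveloping_algebra (tensor_algebra A A').

Section Projective.
Variables A A' : algebra.
Local Notation AA := (tensor_algebra A A').
Implicit Types (s t : seq (A * A')) (u v : AA).

Definition proj_cost s : R :=
  \big[Num.max/0]_(ab <- s) (sna_norm ab.1 * sna_norm ab.2).

Definition proj_norm u : R := inf [set proj_cost s | s in
  [set s | u = \sum_(ab <- s) pure ab.1 ab.2]].

Let N_ge0 (C : algebra) (x : C) : 0 <= sna_norm x.
Proof. exact/sn_ge0/sna_seminorm. Qed.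

Let cost_le s r : 0 <= r ->
  (forall ab, ab \in s -> sna_norm ab.1 * sna_norm ab.2 <= r) -> proj_cost s <= r.
Proof. by move=> r0 h; rewrite /proj_cost big_seq; apply: bigmax_le. Qed.

Let cost_ub s ab : ab \in s -> sna_norm ab.1 * sna_norm ab.2 <= proj_cost s.
Proof.
rewrite /proj_cost; elim: s => [//|cd s IH]; rewrite big_cons inE le_max.
by case/predU1P => [->|/IH ->]; rewrite ?lexx ?orbT.
Qed.

Let cost_ge0 s : 0 <= proj_cost s.
Proof. exact: bigmax_ge_id. Qed.

Let has_lb u : has_lbound [set proj_cost s | s in
  [set s | u = \sum_(ab <- s) pure ab.1 ab.2]].
Proof. by exists 0 => _ [s _ <-]. Qed.

Let proj_le s : proj_norm (tensor_class s) <= proj_cost s.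
Proof. by apply: ge_inf => //; exists s => //=; rewrite tensorE. Qed.

Let proj_ge u r : (forall s, u = tensor_class s -> r <= proj_cost s) ->
  r <= proj_norm u.
Proof.
move=> h; apply: lb_le_inf.
  by exists (proj_cost (repr u)), (repr u) => //=; exact: tensor_sum.
by move=> _ [s /= us <-]; apply: h; rewrite tensorE.
Qed.

Let proj_lt u r : proj_norm u < r -> exists2 s, u = tensor_class s & proj_cost s < r.
Proof.
move=> ur; apply: contrapT => h; suff : r <= proj_norm u by rewrite leNgt ur.
apply: proj_ge => s us; rewrite leNgt; apply/negP => sr; apply: h.
by exists s.
Qed.

Let proj_ge0 u : 0 <= proj_norm u.
Proof. by apply: proj_ge. Qed.

Let class_mul s t : sa_mul (tensor_class s : AA) (tensor_class t) =
  tensor_class [seq (sa_mul ab.1 cd.1, sa_mul ab.2 cd.2) | ab <- s, cd <- t].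
Proof.
elim: s => [|ab s IH] /=; first exact: (linear_fun0 (@tensor_mul_linl _ _ A A' _)).
rewrite tensor_class_cat -IH -cat1s (tensor_class_cat [:: ab] s).
rewrite [LHS](linear_funD (@tensor_mul_linl _ _ A A' _)); congr (_ + _).
elim: t {IH} => [|cd t IH] /=; first exact: (linear_fun0 (@tensor_mul_linr _ _ A A' _)).
rewrite -(cat1s cd t) (tensor_class_cat [:: cd] t).
rewrite [LHS](linear_funD (@tensor_mul_linr _ _ A A' _)) IH.
rewrite -[in RHS]cat1s (tensor_class_cat [:: _] (map _ t)); congr (_ + _).
by case: ab {IH} => a b; case: cd => c d; exact: tensor_mul_pure.
Qed.

Let cost_cat s t : proj_cost (s ++ t) <= Num.max (proj_cost s) (proj_cost t).
Proof.
apply: cost_le => [|ab]; first by rewrite le_max cost_ge0.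
by rewrite mem_cat le_max => /orP[] /cost_ub ->; rewrite ?orbT.
Qed.

Let cost_scale k s :
  proj_cost (sums_scale k s) <= padic_int_abs R k * proj_cost s.
Proof.
apply: cost_le => [|_ /mapP[ab abs ->] /=]; first by rewrite mulr_ge0 ?padic_int_abs_ge0.
apply: (@le_trans _ _ (padic_int_abs R k * (sna_norm ab.1 * sna_norm ab.2))).
  by rewrite mulrA ler_wpM2r// (sn_scale (sna_seminorm A)).
by rewrite ler_wpM2l ?padic_int_abs_ge0 ?cost_ub.
Qed.

Let cost_mul s t :
  proj_cost [seq (sa_mul ab.1 cd.1, sa_mul ab.2 cd.2) | ab <- s, cd <- t] <=
  proj_cost s * proj_cost t.
Proof.
apply: cost_le => [|_ /allpairsP[[ab cd] [/= abs cdt ->]] /=]; first exact: mulr_ge0.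
apply: (@le_trans _ _ ((sna_norm ab.1 * sna_norm cd.1) * (sna_norm ab.2 * sna_norm cd.2))).
  rewrite ler_pM//; first exact: (sn_mul (sna_seminorm A)).
  exact: (sn_mul (sna_seminorm A')).
by rewrite mulrACA ler_pM ?mulr_ge0 ?cost_ub.
Qed.

Let cost_star s :
  proj_cost [seq (sa_star ab.1, sa_star ab.2) | ab <- s] <= proj_cost s.
Proof.
apply: cost_le => // _ /mapP[ab abs ->] /=; apply: (le_trans _ (cost_ub abs)).
rewrite ler_pM//; first exact: (sn_star (sna_seminorm A)).
exact: (sn_star (sna_seminorm A')).
Qed.

Let class_star s : sa_star (tensor_class s : AA) =
  tensor_class [seq (sa_star ab.1, sa_star ab.2) | ab <- s].
Proof.
elim: s => [|ab s IH] /=; first exact: (linear_fun0 (@tensor_star_linear _ _ A A')).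
rewrite -(cat1s ab s) (tensor_class_cat [:: ab] s).
rewrite [LHS](linear_funD (@tensor_star_linear _ _ A A')) [X in _ + X]IH.
rewrite -[in RHS]cat1s (tensor_class_cat [:: _] (map _ s)); congr (_ + _).
by case: ab {IH} => a b; exact: tensor_star_pure.
Qed.

Let lt_mid (a b : R) : (forall r, b < r -> a <= r) -> a <= b.
Proof.
move=> h; apply/ler_addgt0Pr => e e0; apply: h; by rewrite ltrDl.
Qed.

Fact proj_seminorm : star_seminorm proj_norm.
Proof.
split=> [//|u v|k u|u v|u].
- apply: lt_mid => r; rewrite gt_max => /andP[/proj_lt[s -> sr] /proj_lt[t -> tr]].
  rewrite [_ + _]tensor_addE; apply: (le_trans (proj_le _)).
  by apply: (le_trans (cost_cat _ _)); rewrite ge_max !ltW.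
- have [->|k0] := eqVneq k 0.
    rewrite scale0r padic_int_abs0 mul0r; apply: (le_trans (proj_le [::])).
    exact: cost_le.
  have kp : 0 < padic_int_abs R k.
    by rewrite lt_def padic_int_abs_eq0 k0 padic_int_abs_ge0.
  rewrite mulrC -ler_pdivrMr//; apply: proj_ge => s ->.
  rewrite ler_pdivrMr// mulrC [_ *: _]tensor_scaleE.
  exact: le_trans (proj_le _) (cost_scale _ _).
- have h s t : u = tensor_class s -> v = tensor_class t ->
      proj_norm (sa_mul u v) <= proj_cost s * proj_cost t.
    by move=> -> ->; rewrite class_mul; apply: le_trans (proj_le _) (cost_mul _ _).
  have h' t : v = tensor_class t -> proj_norm (sa_mul u v) <= proj_norm u * proj_cost t.
    move=> vt; have [t0|t0] := eqVneq (proj_cost t) 0.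
      have := h (repr u) t (esym (tensor_reprK u)) vt.
      by rewrite t0 !mulr0.
    have tp : 0 < proj_cost t by rewrite lt_def t0 cost_ge0.
    rewrite -ler_pdivrMr//; apply: proj_ge => s us.
    by rewrite ler_pdivrMr// h.
  have [u0|u0] := eqVneq (proj_norm u) 0.
    have := h' (repr v) (esym (tensor_reprK v)).
    by rewrite u0 !mul0r.
  have up : 0 < proj_norm u by rewrite lt_def u0 proj_ge0.
  rewrite mulrC -ler_pdivrMr//; apply: proj_ge => t vt.
  by rewrite ler_pdivrMr// mulrC h'.
- apply: proj_ge => s ->; rewrite class_star.
  exact: le_trans (proj_le _) (cost_star _).
Qed.

Definition proj_tensor : algebra := completion (SeminormedAlgebra proj_seminorm).

End Projective.

Section Spatial.
Variables X Y : pointedType.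

Definition fun_tensor (xi : X -> Qp) (eta : Y -> Qp) : X * Y -> Qp :=
  fun xy => xi xy.1 * eta xy.2.

Lemma delta_tensor (x : X) (y : Y) :
  fun_tensor (delta x : padic_fun p_pr X) (delta y : padic_fun p_pr Y) =
  (delta (x, y) : padic_fun p_pr (X * Y)%type) :> (X * Y -> Qp).
Proof.
apply/funext => -[x' y']; rewrite /fun_tensor /= xpair_eqE.
by case: eqVneq => _; case: eqVneq => _; rewrite ?mul1r ?mulr0 ?mul0r.
Qed.

(* U (x) V is the unique contraction with these values at the functions
   delta x (x) delta y = delta (x, y) (delta_tensor); the default value 0 of xget
   is never reached. *)
Definition op_tensor (U : B X) (V : B Y) : B (X * Y)%type :=
  xget 0 [set W : B (X * Y)%type | forall x y,
    W (delta (x, y)) = fun_tensor (U (delta x)) (V (delta y)) :> (X * Y -> Qp)].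

Variables (A A' : algebra) (f : A -> B X) (g : A' -> B Y).

Definition spatial_rep : tensor_algebra A A' -> B (X * Y)%type :=
  tensor_lift (fun a b => op_tensor (f a) (g b)).

Definition subalgebra (Z : pointedType) (S : set (B Z)) :=
  [/\ S 0, forall k T T', S T -> S T' -> S (k *: T + T') &
      forall T T', S T -> S T' -> S (contraction_mul T T')].

Definition min_tensor : set (B (X * Y)%type) :=
  norm_closure (smallest (@subalgebra (X * Y)%type)
    [set op_tensor (f ab.1) (g ab.2) | ab in [set: A * A']]).

End Spatial.

Section CanonicalNorm.
Variable M : lmodType Zp.

Definition padic_order (x : M) : \bar R :=
  ereal_sup [set n%:R%:E | n in [set n : nat | exists y : M, x = p%:R ^+ n *: y]].

(* p ^ (- padic_order x), with p ^ (-oo) = 0. *)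
Definition canonical_norm (x : M) : R :=
  if padic_order x is r%:E then p%:R `^ (- r) else 0.

Definition is_canonical_norm (N : M -> R) :=
  [/\ forall x : M, p%:R *: x = 0 -> x = 0,
      forall x : M, (forall n, exists y : M, x = p%:R ^+ n *: y) -> x = 0 &
      forall x, N x = canonical_norm x].

End CanonicalNorm.

End OperatorAlgebras.

(* Main.v *)
From mathcomp Require Import all_boot all_order all_algebra.
From mathcomp Require Import all_classical all_reals ereal normedtype exp ring.
Require Import Defs.

Set Implicit Arguments.
Unset Strict Implicit.
Unset Printing Implicit Defensive.

Import Order.TTheory GRing.Theory Num.Theory numFieldNormedType.Exports.
Local Open Scope classical_set_scope.
Local Open Scope ring_scope.

(** The three norms at stake on the algebraic tensor product AB of A and B are
    the spatial norm N u = |spatial_rep u|, the universal norm u_norm and the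
    projective norm proj_norm; N is assumed to be the canonical p-adic norm, and
    it turns out that all three coincide.

    Among the functions S bounded by 1 with S (k u) <= |k| S u, the canonical
    norm is the largest: an element u = p ^ m v of order m has
    S u <= p ^ (- m) S v <= p ^ (- m) (le_canonical_norm). Hence u_norm <= N and
    proj_norm <= N, the latter being bounded by 1 since the norms of A and B are.
    Conversely N <= u_norm because spatial_rep is itself a *-homomorphism into
    contractions (spatial_rep_hom). Finally, an element of A of canonical norm
    p ^ (- n) is divisible by p ^ n, and likewise in B, so that
    N (a (x) b) <= |a| |b|, and N <= proj_norm follows because N is ultrametric
    (canonical_le_proj_norm).

    The maximal and projective tensor products are thus completions of one and
    the same seminormed algebra, and spatial_rep, being isometric for this norm,
    extends to the completion with range the closure of its range
    (completion_ext_isom, range_completion_ext); the range of spatial_rep is the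
    algebra generated by the operators a (x) b (range_spatial_rep).

    This rests on three facts about contractions. First, U (x) V exists: it is
    the product of U (x) 1 and 1 (x) V, where 1 (x) V acts as V on each slice
    zeta (x, -) of a function zeta on X * Y; it is determined by its values on
    the functions delta (x, y) because finitely supported functions are
    tau-dense (contraction_deltaP). Second, the pairing of two functions on X * Y
    is the sum of the pairings of their slices, so adjoints are compatible with
    tensor products (is_adjoint_op_tensor). Third, the contractions form a
    complete space on which the product and the adjoint are continuous
    (contraction_complete, contraction_limM, contraction_lim_adjoint). *)

(** * Canonical norms *)

Section CanonicalNorms.
Variables (R : realType) (p : nat) (p_pr : prime p).
Local Notation Zp := (padic_int p_pr).
Local Notation pR := (p%:R : R).

Lemma padic_int_abs_pX n : padic_int_abs R (p%:R ^+ n : Zp) = pR ^- n.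
Proof.
elim: n => [|n IH]; first by rewrite !expr0 padic_int_abs1 invr1.
by rewrite !exprS padic_int_absM IH padic_int_abs_p invfM.
Qed.

Section Module.
Variables (M : lmodType Zp) (N : M -> R).
Hypothesis N_can : is_canonical_norm N.

Lemma canonical_norm0 : N 0 = 0.
Proof.
have [_ _ ->] := N_can; rewrite /canonical_norm.
suff -> : padic_order R (0 : M) = +oo%E by [].
apply/eqyP => r r0; have [n rn] : exists n : nat, r <= n%:R.
  by exists (Num.bound r); apply/ltW/archi_boundP/ltW.
apply: (@le_trans _ _ n%:R%:E); first by rewrite lee_fin.
by apply: ereal_sup_ubound; exists n => //=; exists 0; rewrite scaler0.
Qed.

(** A nonzero element x has a largest exponent m such that p ^ m divides it, and
    its canonical norm is p ^ (- m). *)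
Lemma canonical_normP x : x != 0 -> exists m y, [/\ x = p%:R ^+ m *: y,
  N x = pR ^- m & forall n z, x = p%:R ^+ n *: z -> (n <= m)%N].
Proof.
move=> x0; have [_ sep NE] := N_can.
pose D n := `[< exists y, x = p%:R ^+ n *: y >].
have D0 : exists n, D n by exists 0%N; apply/asboolP; exists x; rewrite expr0 scale1r.
have Dle m n : (m <= n)%N -> D n -> D m.
  move=> mn /asboolP[y xy]; apply/asboolP; exists (p%:R ^+ (n - m) *: y).
  by rewrite xy scalerA -exprD subnKC.
have [k kN] : exists k, ~~ D k.
  apply: contrapT => /forallNP h; move/eqP: x0; apply; apply: sep => n.
  by have /negP := h n; rewrite negbK => /asboolP.
have Dub n : D n -> (n <= k)%N.
  by move=> Dn; rewrite leqNgt; apply: contra kN => /ltnW /Dle; exact.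
case: (ex_maxnP D0 Dub) => m /[dup] Dm /asboolP[y xy] mmax.
exists m, y; split=> // [|n z xz]; last by apply: mmax; apply/asboolP; exists z.
rewrite NE /canonical_norm; suff -> : padic_order R x = m%:R%:E.
  by rewrite powRN powR_mulrn // ltW// prime_R_gt0.
apply/eqP; rewrite eq_le; apply/andP; split.
  apply: ge_ereal_sup => _ [n /= xn <-]; rewrite lee_fin ler_nat.
  by apply: mmax; apply/asboolP.
by apply: ereal_sup_ubound; exists m => //=; exists y.
Qed.

Lemma canonical_norm_le1 x : N x <= 1.
Proof.
have [->|/canonical_normP[m [y [_ -> _]]]] := eqVneq x 0.
  by rewrite canonical_norm0 ler01.
by have := prime_RX_le R p_pr m 0; rewrite expr0 invr1 leq0n => ->.
Qed.

Lemma canonical_norm_pX n y : N (p%:R ^+ n *: y) <= pR ^- n.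
Proof.
have [->|/canonical_normP[m [z [_ -> h]]]] := eqVneq (p%:R ^+ n *: y) 0.
  by rewrite canonical_norm0 ltW// prime_RX_gt0.
by rewrite prime_RX_le; move: h => /(_ n y erefl).
Qed.

End Module.

(** The canonical norm dominates every S that is bounded by 1 and satisfies
    S (k x) <= |k| S x. *)
Lemma le_canonical_norm (M : lmodType Zp) (N S : M -> R) :
  is_canonical_norm N ->
  (forall k x, S (k *: x) <= padic_int_abs R k * S x) -> (forall x, S x <= 1) ->
  forall x, S x <= N x.
Proof.
move=> hN SZ S1 x; have [->|/(canonical_normP hN)[m [y [-> -> _]]]] := eqVneq x 0.
  rewrite (canonical_norm0 hN); have := SZ 0 0.
  by rewrite scaler0 padic_int_abs0 mul0r.
apply: (le_trans (SZ _ _)); rewrite padic_int_abs_pX.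
by rewrite ler_piMr// ltW// prime_RX_gt0.
Qed.

End CanonicalNorms.

(** * Contractions and their adjoints *)

Section PadicFunctionFacts.
Variables (R : realType) (p : nat) (p_pr : prime p).
Local Notation Zp := (padic_int p_pr).
Local Notation Qp := (padic_num p_pr).
Local Notation frac := (@FracField.tofrac (padic_int p_pr)).
Local Notation integral := (@padic_integral _ p_pr).
Local Notation pabs := (padic_abs R).
Local Notation pR := (p%:R : R).

Lemma exists_pX_lt (e : R) : 0 < e -> exists n, pR ^- n < e.
Proof.
move=> e0; pose n := Num.bound e^-1; exists n.
rewrite invf_plt ?posrE ?exprn_gt0 ?prime_R_gt0//.
apply: (lt_trans (archi_boundP _)); first by rewrite invr_ge0 ltW.
by rewrite -natrX ltr_nat ltn_expl// prime_gt1.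
Qed.

Lemma padic_abs_pX n : pabs (frac (p%:R ^+ n)) = pR ^- n.
Proof. by rewrite padic_abs_int padic_int_abs_pX. Qed.

Lemma tofrac_pX_neq0 n : frac (p%:R ^+ n) != 0.
Proof. by rewrite -(padic_abs_eq0 R) padic_abs_pX gt_eqF// prime_RX_gt0. Qed.

Lemma integral_pXM n (a : Qp) : pabs a <= pR ^+ n -> frac (p%:R ^+ n) * a \in integral.
Proof.
move=> an; apply/(padic_integralP R); rewrite padic_absM padic_abs_pX.
by rewrite ler_pdivrMl ?mulr1// exprn_gt0// prime_R_gt0.
Qed.

Lemma padic_scale_integral (a : Qp) : exists n, frac (p%:R ^+ n) * a \in integral.
Proof.
have [->|a0] := eqVneq a 0; first by exists 0%N; rewrite mulr0 rpred0.
have a_gt0 : 0 < pabs a by rewrite lt_def padic_abs_eq0 a0 padic_abs_ge0.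
have [n hn] : exists n, pR ^- n < (pabs a)^-1 by apply: exists_pX_lt; rewrite invr_gt0.
exists n; apply: integral_pXM; move: hn.
by rewrite ltf_pV2 ?posrE ?exprn_gt0 ?prime_R_gt0// => /ltW.
Qed.

Section Functions.
Variable X : pointedType.
Local Notation QpX := (padic_fun p_pr X).
Implicit Types xi eta : QpX.

Lemma padic_fun_scale_integral xi :
  exists n, forall x, (p%:R ^+ n *: xi) x \in integral.
Proof.
have [r rE] := (finite_seqP _).1 (padic_fun_fin xi).
have [n hn] : exists n, forall x, x \in r -> frac (p%:R ^+ n) * xi x \in integral.
  elim: r {rE} => [|x r [n hn]]; first by exists 0%N.
  have [m hm] := padic_scale_integral (xi x); exists (m + n)%N => y.
  rewrite exprD tofracM inE => /predU1P[->|/hn yn].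
    by rewrite mulrAC padic_integralM// padic_integral_frac.
  by rewrite -mulrA padic_integralM// padic_integral_frac.
exists n => x; rewrite padic_funZ.
case: (boolP (xi x \in integral)) => xx.
  by rewrite padic_integralM// padic_integral_frac.
apply: hn; suff : [set` r] x by [].
by rewrite -rE.
Qed.

Lemma delta_integral x y : (delta x : QpX) y \in integral.
Proof. by rewrite /=; case: ifP => _; rewrite -?tofrac0 -?tofrac1 padic_integral_frac. Qed.

Lemma padic_fun_pXZ_eq0 n xi : p%:R ^+ n *: xi = 0 -> xi = 0.
Proof.
move=> h; apply: padic_funP => x; have := congr1 (fun f : QpX => f x) h.
rewrite padic_funZ padic_fun0 => /eqP.
by rewrite mulf_eq0 (negPf (tofrac_pX_neq0 n)) => /eqP.
Qed.

End Functions.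

Section Pairing.
Variable X : pointedType.
Local Notation QpX := (padic_fun p_pr X).
Implicit Types xi eta : QpX.
Local Notation quot := (\pi_(padic_quot p_pr)%qT).

Lemma quot_integral (a : Qp) : a \in integral -> quot a = 0.
Proof.
by move=> ha; rewrite -[RHS](raddf0 quot); apply/padic_quotP; rewrite subr0.
Qed.

Lemma pairing_finite xi eta : finite_set [set x | xi x * eta x \notin integral].
Proof.
apply: (sub_finite_set _ (_ : finite_set ([set x | xi x \notin integral] `|`
  [set x | eta x \notin integral]))); last by rewrite finite_setU; split; exact: padic_fun_fin.
move=> x /= h; apply/orP; rewrite -negb_and; apply: contra h => /andP[? ?].
exact: padic_integralM.
Qed.

(** The pairing may be computed on any set P outside of which all terms are
    integral. *)
Lemma pairingE (P : set X) xi eta : [set x | xi x * eta x \notin integral] `<=` P ->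
  pairing xi eta = \sum_(x \in P) quot (xi x * eta x).
Proof.
move=> hP; rewrite /pairing; apply/esym/fsbig_widen => // x [_ Px] /=.
by apply: quot_integral; apply/negPn/negP => /hP.
Qed.

Lemma pairing_integral xi eta : (forall x, xi x * eta x \in integral) -> pairing xi eta = 0.
Proof. by move=> h; rewrite /pairing fsbig1// => x _; exact: quot_integral. Qed.

Lemma pairingDl xi xi' eta : pairing (xi + xi') eta = pairing xi eta + pairing xi' eta.
Proof.
pose P := [set x | xi x * eta x \notin integral] `|` [set x | xi' x * eta x \notin integral].
rewrite !(@pairingE P).
- rewrite -fsbig_split; last by rewrite finite_setU; split; exact: pairing_finite.
  by apply: eq_fsbigr => x _; rewrite padic_funD mulrDl raddfD.
- by move=> x; right.
- by move=> x; left.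
- move=> x; apply: contraPP => /not_orP[/= /negP + /negP].
  rewrite !negbK => h h'; apply/negP; rewrite negbK.
  have -> : (xi + xi') x * eta x = xi x * eta x + xi' x * eta x by rewrite -mulrDl.
  exact: rpredD.
Qed.

Lemma pairingC xi eta : pairing xi eta = pairing eta xi.
Proof. by apply: eq_fsbigr => x _; rewrite mulrC. Qed.

Lemma pairingDr xi eta eta' : pairing xi (eta + eta') = pairing xi eta + pairing xi eta'.
Proof. by rewrite pairingC pairingDl ![pairing _ xi]pairingC. Qed.

Lemma pairing0l eta : pairing 0 eta = 0.
Proof. by apply: pairing_integral => x; rewrite padic_fun0 mul0r rpred0. Qed.

Lemma pairing0r xi : pairing xi 0 = 0.
Proof. by rewrite pairingC pairing0l. Qed.

Lemma pairingZ k xi eta : pairing (k *: xi) eta = pairing xi (k *: eta).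
Proof. by apply: eq_fsbigr => x _; rewrite !padic_funZ mulrCA mulrA. Qed.

Lemma pairingNl xi eta : pairing (- xi) eta = - pairing xi eta.
Proof. by apply/eqP; rewrite -addr_eq0 -pairingDl addNr pairing0l. Qed.

End Pairing.

Section Adjoints.
Variable X : pointedType.
Local Notation QpX := (padic_fun p_pr X).
Local Notation B := (contraction R p_pr X).
Implicit Types (xi eta : QpX) (S T : B).

Lemma contraction_norm_eq0 T : contraction_norm T = 0 -> T = 0.
Proof.
move=> T0; apply: contraction_eqP => xi; have [n hn] := padic_fun_scale_integral xi.
have [lT _ _] := contractionP T.
apply: (@padic_fun_pXZ_eq0 _ n); rewrite -(linear_opZ lT); apply: padic_funP => x.
apply/eqP; rewrite padic_fun0 -(padic_abs_eq0 R) eq_le padic_abs_ge0 andbT.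
by rewrite -T0; exact: contraction_norm_ub.
Qed.

Lemma contraction_norm0 : contraction_norm (0 : B) = 0.
Proof.
apply/eqP; rewrite eq_le contraction_norm_ge0 andbT; apply/contraction_norm_le => xi _ x.
by rewrite contraction0 padic_fun0 padic_abs0.
Qed.

Lemma contraction_normN T : contraction_norm (- T) = contraction_norm T.
Proof.
have le S : contraction_norm (- S) <= contraction_norm S.
  rewrite -scaleN1r; apply: (le_trans (contraction_normZ _ _)).
  by rewrite padic_int_absN padic_int_abs1 mul1r.
by apply/eqP; rewrite eq_le le -{1}[T]opprK le.
Qed.

(** A contraction vanishing on all delta x is zero, as the finitely supported
    functions are tau-dense. *)
Lemma contraction_delta0 T : (forall x, T (delta x) = 0) -> T = 0.
Proof.
move=> T0; have [lT cT T1] := contractionP T.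
have ct := (tau_continuousP lT T1).1 cT.
apply: contraction_norm_eq0; apply/eqP; rewrite eq_le contraction_norm_ge0 andbT.
apply/contraction_norm_le => xi hxi x; apply/ler_addgt0Pr => e e0; rewrite add0r.
have [G [finG [d [d0 h]]]] := ct [set x] (finite_set1 x) e e0.
have [r rE] := (finite_seqP _).1 finG.
(* Subtracting multiples of delta y for the finitely many y of G makes xi vanish
   on G without changing T xi. *)
have [xi' [hxi' <- xi'0]] : exists xi', [/\ forall x, xi' x \in integral,
    T xi' = T xi & forall x, x \in r -> xi' x = 0].
  elim: r {rE} => [|y r [xi' [hxi' Txi xi'0]]]; first by exists xi.
  have /asboolP[k kE] := hxi' y; exists (xi' - k *: delta y); split=> [z||z].
  - rewrite padic_funB rpredB// padic_funZ padic_integralM ?padic_integral_frac//.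
    exact: delta_integral.
  - by rewrite -scaleN1r addrC lT (linear_opZ lT) T0 !scaler0 add0r.
  - rewrite inE padic_funB padic_funZ /=; case: eqVneq => [->|_ /= /xi'0 ->].
      by rewrite kE mulr1 subrr.
    by rewrite mulr0 subr0.
apply/ltW/h => // y Gy; rewrite xi'0 ?padic_abs0//.
by move: Gy; rewrite rE.
Qed.

Lemma contraction_deltaP T S : (forall x y, T (delta x) y = S (delta x) y) -> T = S.
Proof.
move=> h; apply/subr0_eq/contraction_delta0 => x; apply: padic_funP => y.
by rewrite contractionB padic_funB h subrr.
Qed.

(** S is the adjoint of T for the pairing; unlike the function adjoint, this
    relation asserts that the adjoint exists. *)
Definition is_adjoint T S := forall xi eta, pairing (T xi) eta = pairing xi (S eta).

Lemma is_adjoint0 : is_adjoint 0 0.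
Proof. by move=> xi eta; rewrite !contraction0 pairing0l pairing0r. Qed.

Lemma is_adjointD T T' S S' :
  is_adjoint T S -> is_adjoint T' S' -> is_adjoint (T + T') (S + S').
Proof. by move=> h h' xi eta; rewrite !contractionD pairingDl pairingDr h h'. Qed.

Lemma is_adjointZ k T S : is_adjoint T S -> is_adjoint (k *: T) (k *: S).
Proof.
move=> h xi eta; have [lS _ _] := contractionP S.
by rewrite !contractionZ pairingZ h (linear_opZ lS).
Qed.

Lemma is_adjointN T S : is_adjoint T S -> is_adjoint (- T) (- S).
Proof. by rewrite -!scaleN1r; exact: is_adjointZ. Qed.

Lemma is_adjointM T T' S S' : is_adjoint T S -> is_adjoint T' S' ->
  is_adjoint (contraction_mul T T') (contraction_mul S' S).
Proof. by move=> h h' xi eta; rewrite /= h h'. Qed.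

Lemma is_adjoint_unique T S S' : is_adjoint T S -> is_adjoint T S' -> S = S'.
Proof.
move=> h /is_adjointN h'; apply/subr0_eq/contraction_norm_eq0.
have /pairing_adjoint_le := is_adjointD h h'; rewrite subrr contraction_norm0 => le0.
by apply/eqP; rewrite eq_le le0 contraction_norm_ge0.
Qed.

Lemma is_adjoint_adjoint T S : is_adjoint T S -> adjoint T = S.
Proof.
move=> h; rewrite /adjoint; case: xgetP => [S' _ /= h'|/(_ S)//].
exact: is_adjoint_unique h' h.
Qed.

(** Every operator in the image of a *-homomorphism has an adjoint: otherwise
    f (sa_star a) = adjoint (f a) would be the default value 0, so that
    f a = adjoint (f (sa_star a)) = adjoint 0 = 0, which has an adjoint. *)
Lemma star_hom_is_adjoint (C : star_algebra p_pr) (f : C -> B) a :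
  star_hom f -> is_adjoint (f a) (f (sa_star a)).
Proof.
move=> [_ _ fs]; rewrite fs.
have [[S hS]|nS] := pselect (exists S, is_adjoint (f a) S).
  by rewrite (is_adjoint_adjoint hS).
have a0 : adjoint (f a) = 0.
  by rewrite /adjoint; case: xgetP => // S _ /= hS; case: nS; exists S.
have fa : f a = 0 by rewrite -[a]sa_starK fs fs a0 (is_adjoint_adjoint is_adjoint0).
by rewrite a0 fa; exact: is_adjoint0.
Qed.

End Adjoints.
End PadicFunctionFacts.

(** * The tensor product of two contractions *)

Section Amplification.
Variables (R : realType) (p : nat) (p_pr : prime p).
Local Notation integral := (@padic_integral _ p_pr).
Local Notation pabs := (padic_abs R).
Local Notation quot := (\pi_(padic_quot p_pr)%qT).
Variables (Z I W : pointedType) (i : Z -> I) (w : Z -> W) (k : I -> W -> Z).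
Hypotheses (kiw : forall z, k (i z) (w z) = z).
Hypotheses (ik : forall a b, i (k a b) = a) (wk : forall a b, w (k a b) = b).
Implicit Types (zeta eta : padic_fun p_pr Z) (U V : contraction R p_pr W).

Fact slice_subproof zeta a : (fun b => zeta (k a b)) \in @almost_integral _ p_pr W.
Proof.
apply/asboolP/(sub_finite_set _ (finite_image w (padic_fun_fin zeta))) => b /= h.
by exists (k a b).
Qed.

(** The restriction of zeta to the fibre of i over a. Here (i, w) identifies Z
    with the product of I and W, and k is the inverse bijection; taking Z = X * Y
    with either coordinate as i covers both U (x) 1 and 1 (x) V. *)
Definition slice zeta a : padic_fun p_pr W := PadicFun (slice_subproof zeta a).

Lemma sliceE zeta a b : slice zeta a b = zeta (k a b). Proof. by []. Qed.

Lemma slice_linear a : linear (slice^~ a).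
Proof. by move=> c zeta eta; exact: padic_funP. Qed.

Lemma slice_delta a b a' :
  slice (delta (k a b)) a' = if a' == a then delta b else 0.
Proof.
apply: padic_funP => b'; rewrite sliceE /=.
have -> : (k a' b' == k a b) = (a' == a) && (b' == b).
  apply/eqP/andP => [e|[/eqP-> /eqP->//]].
  by rewrite -(ik a' b') e ik -(wk a' b') e wk !eqxx.
by case: eqVneq.
Qed.

Fact amp_fun_subproof V zeta :
  (fun z => V (slice zeta (i z)) (w z)) \in @almost_integral _ p_pr Z.
Proof.
apply/asboolP; pose P := i @` [set z | zeta z \notin integral].
have finP : finite_set P by apply: finite_image; exact: padic_fun_fin.
apply: (sub_finite_set _ (bigcup_finite finP (fun a _ =>
  finite_image (k a) (padic_fun_fin (V (slice zeta a)))))) => z /= hz.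
exists (i z) => /=; last by exists (w z).
(* Off P the slices of zeta are integral, hence so are their images under V. *)
apply: contrapT => nP; move/negP: hz; apply; apply: contraction_integral => b.
rewrite sliceE; apply/negPn/negP => h; apply: nP; exists (k (i z) b) => //.
Qed.

(** The function whose slice over each a is V (slice zeta a). *)
Definition amp_fun V zeta : padic_fun p_pr Z := PadicFun (amp_fun_subproof V zeta).

Lemma slice_amp_fun V zeta a : slice (amp_fun V zeta) a = V (slice zeta a).
Proof. by apply: padic_funP => b; rewrite sliceE /= ik wk. Qed.

Fact amp_subproof V : amp_fun V \in @contractive_operator R p p_pr Z.
Proof.
have [lV cV V1] := contractionP V; apply/asboolP.
have lA : linear (amp_fun V).
  by move=> c zeta eta; apply: padic_funP => z /=; rewrite slice_linear lV.
have A1 : (op_norm R (amp_fun V) <= 1)%E.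
  by apply/op_norm_le1 => zeta hz z /=; apply: contraction_integral => b; rewrite sliceE.
split=> //; apply/tau_continuousP => // F finF e e0.
have [G [finG [d [d0 h]]]] := (tau_continuousP lV V1).1 cV _ (finite_image w finF) e e0.
exists ((fun ab => k ab.1 ab.2) @` ((i @` F) `*` G)); split.
  by apply: finite_image; apply: finite_setX => //; exact: finite_image.
exists d; split=> // zeta hz hG z Fz /=; apply: h => [b|b Gb|]; last by exists z.
  by rewrite sliceE.
by rewrite sliceE; apply: hG; exists (i z, b) => //; split=> //; exists z.
Qed.

(** The contraction acting as V on every slice. *)
Definition amp V : contraction R p_pr Z := Contraction (amp_subproof V).

Lemma ampE V zeta z : amp V zeta z = V (slice zeta (i z)) (w z). Proof. by []. Qed.

Lemma amp_linear : linear amp.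
Proof. by move=> c V U; apply: contraction_eqP => zeta; exact: padic_funP. Qed.

Lemma ampM U V : amp (contraction_mul U V) = contraction_mul (amp U) (amp V).
Proof.
apply: contraction_eqP => zeta; apply: padic_funP => z.
by rewrite ampE /= slice_amp_fun.
Qed.

(** Fubini for the pairing. *)
Lemma pairing_slices zeta eta :
  pairing zeta eta = \sum_(a \in [set: I]) pairing (slice zeta a) (slice eta a).
Proof.
pose S := [set z | zeta z * eta z \notin integral].
have finS : finite_set S := pairing_finite zeta eta.
pose P := i @` S; pose Q := w @` S.
have finP : finite_set P by exact: finite_image.
have finQ : finite_set Q by exact: finite_image.
have inS a b : slice zeta a b * slice eta a b \notin integral -> P a /\ Q b.
  by move=> h; split; exists (k a b).
rewrite -(fsbig_widen P)//; last first.
  move=> a [_ nP] /=; apply: pairing_integral => b.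
  by apply/negPn/negP => /inS[].
rewrite /pairing (reindex_fsbigT (fun ab : I * W => k ab.1 ab.2)); last first.
  by exists (fun z => (i z, w z)) => [[a b]|z] /=; rewrite ?ik ?wk.
rewrite -(fsbig_widen (P `*` Q))//; last first.
  move=> [a b] [_ nPQ] /=; apply: quot_integral; apply/negPn/negP => /inS.
  exact: nPQ.
rewrite -(pair_fsbig _ (fun a b => quot (zeta (k a b) * eta (k a b))) finP finQ)/=.
apply: eq_fsbigr => a _; apply: fsbig_widen => // b [_ nQ] /=.
by apply: quot_integral; apply/negPn/negP => /inS[].
Qed.

Lemma is_adjoint_amp U V : is_adjoint U V -> is_adjoint (amp U) (amp V).
Proof.
move=> UV zeta eta; rewrite !pairing_slices; apply: eq_fsbigr => a _.
by rewrite !slice_amp_fun UV.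
Qed.

End Amplification.

Section OpTensor.
Variables (R : realType) (p : nat) (p_pr : prime p) (X Y : pointedType).
Local Notation BX := (contraction R p_pr X).
Local Notation BY := (contraction R p_pr Y).
Local Notation BXY := (contraction R p_pr (X * Y)%type).

(** The operators U (x) 1 and 1 (x) V. *)
Definition ampl : BX -> BXY := @amp R p p_pr (X * Y)%type Y X snd fst
  (fun y x => (x, y)) (fun xy => esym (surjective_pairing xy))
  (fun _ _ => erefl) (fun _ _ => erefl).
Definition ampr : BY -> BXY := @amp R p p_pr (X * Y)%type X Y fst snd
  (fun x y => (x, y)) (fun xy => esym (surjective_pairing xy))
  (fun _ _ => erefl) (fun _ _ => erefl).

Implicit Types (U : BX) (V : BY).

Let ampr_delta V x y : ampr V (delta (x, y)) =
  fun_tensor (delta x : padic_fun p_pr X) (V (delta y)) :> (X * Y -> padic_num p_pr).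
Proof.
apply/funext => -[x' y']; rewrite ampE /=.
rewrite (@slice_delta _ p_pr _ X Y fst snd (fun x y => (x, y)) (fun _ _ => erefl) _ x y).
rewrite /fun_tensor /=; case: eqVneq => [|_]; first by rewrite mul1r.
by have [lV _ _] := contractionP V; rewrite linear_op0// mul0r.
Qed.

Let ampl_delta U x y : ampl U (delta (x, y)) =
  fun_tensor (U (delta x)) (delta y : padic_fun p_pr Y) :> (X * Y -> padic_num p_pr).
Proof.
apply/funext => -[x' y']; rewrite ampE /=.
rewrite (@slice_delta _ p_pr _ Y X snd fst (fun y x => (x, y)) (fun _ _ => erefl) _ y x).
rewrite /fun_tensor /=; case: eqVneq => [|_]; first by rewrite mulr1.
by have [lU _ _] := contractionP U; rewrite linear_op0// mulr0.
Qed.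

Let ampl_ampr_delta U V x y : contraction_mul (ampl U) (ampr V) (delta (x, y)) =
  fun_tensor (U (delta x)) (V (delta y)) :> (X * Y -> padic_num p_pr).
Proof.
have [lU _ _] := contractionP U.
apply/funext => -[x' y']; rewrite [LHS](_ : _ = U (@slice _ p_pr _ Y X fst (fun y x => (x, y))
  (fun _ _ => erefl) (ampr V (delta (x, y))) y') x')//.
have /asboolP[c cE] := contraction_integral V (delta_integral p_pr y) y'.
rewrite (_ : slice _ _ _ = c *: delta x); last first.
  by apply: padic_funP => x1; rewrite sliceE ampr_delta padic_funZ /fun_tensor cE mulrC.
by rewrite (linear_opZ lU) padic_funZ /fun_tensor /= cE mulrC.
Qed.

Let ampr_ampl_delta U V x y : contraction_mul (ampr V) (ampl U) (delta (x, y)) =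
  fun_tensor (U (delta x)) (V (delta y)) :> (X * Y -> padic_num p_pr).
Proof.
have [lV _ _] := contractionP V.
apply/funext => -[x' y']; rewrite [LHS](_ : _ = V (@slice _ p_pr _ X Y snd (fun x y => (x, y))
  (fun _ _ => erefl) (ampl U (delta (x, y))) x') y')//.
have /asboolP[c cE] := contraction_integral U (delta_integral p_pr x) x'.
rewrite (_ : slice _ _ _ = c *: delta y); last first.
  by apply: padic_funP => y1; rewrite sliceE ampl_delta padic_funZ /fun_tensor cE.
by rewrite (linear_opZ lV) padic_funZ /fun_tensor /= cE.
Qed.

(** In particular the default value in the definition of op_tensor is not taken. *)
Lemma op_tensorE U V : op_tensor U V = contraction_mul (ampl U) (ampr V).
Proof.
rewrite /op_tensor; case: xgetP => [T _ /= hT|/(_ (contraction_mul (ampl U) (ampr V)))].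
  by apply: contraction_deltaP => -[x y] xy; rewrite hT ampl_ampr_delta.
by case=> x y; exact: ampl_ampr_delta.
Qed.

Lemma amplr_comm U V :
  contraction_mul (ampl U) (ampr V) = contraction_mul (ampr V) (ampl U).
Proof.
by apply: contraction_deltaP => -[x y] xy; rewrite ampl_ampr_delta ampr_ampl_delta.
Qed.

Lemma op_tensor_linl V : linear (fun U => op_tensor U V).
Proof. by move=> c U U'; rewrite !op_tensorE /ampl amp_linear; exact: contraction_eqP. Qed.

Lemma op_tensor_linr U : linear (fun V => op_tensor U V).
Proof.
move=> c V V'; rewrite !op_tensorE /ampr amp_linear; apply: contraction_eqP => xi /=.
by have [lU _ _] := contractionP (ampl U); exact: lU.
Qed.

Lemma op_tensorM U U' V V' :
  op_tensor (contraction_mul U U') (contraction_mul V V') =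
  contraction_mul (op_tensor U V) (op_tensor U' V').
Proof.
rewrite !op_tensorE /ampl /ampr !ampM -/ampl -/ampr; apply: contraction_eqP => xi /=.
congr (ampl U _); have := congr1 (fun T : BXY => T (ampr V' xi)) (amplr_comm U' V).
by move=> /= ->.
Qed.

Lemma is_adjoint_op_tensor U U' V V' : is_adjoint U U' -> is_adjoint V V' ->
  is_adjoint (op_tensor U V) (op_tensor U' V').
Proof.
move=> hU hV; rewrite !op_tensorE amplr_comm.
by apply: is_adjointM; exact: is_adjoint_amp.
Qed.

End OpTensor.

(** * The spatial representation *)

Section SpatialRepresentation.
Variables (R : realType) (p : nat) (p_pr : prime p) (X Y : pointedType).
Variables (A B : seminormed_algebra p_pr R).
Variables (f : A -> contraction R p_pr X) (g : B -> contraction R p_pr Y).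
Hypotheses (f_hom : star_hom f) (g_hom : star_hom g).
Local Notation rep := (spatial_rep f g).
Local Notation AB := (tensor_algebra A B).

Let lin_l b : linear (fun a => op_tensor (f a) (g b)).
Proof. by have [lf _ _] := f_hom; move=> k a a'; rewrite lf op_tensor_linl. Qed.

Let lin_r a : linear (fun b => op_tensor (f a) (g b)).
Proof. by have [lg _ _] := g_hom; move=> k b b'; rewrite lg op_tensor_linr. Qed.

Lemma spatial_rep_pure a b : rep (pure a b) = op_tensor (f a) (g b).
Proof. by rewrite /spatial_rep tensor_lift_pure. Qed.

Lemma spatial_rep_linear : linear rep.
Proof. exact: tensor_lift_linear. Qed.

Let rep0 : rep 0 = 0. Proof. exact: (linear_fun0 spatial_rep_linear). Qed.
Let repD u v : rep (u + v) = rep u + rep v.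
Proof. exact: (linear_funD spatial_rep_linear). Qed.

Lemma spatial_repM (u v : AB) : rep (sa_mul u v) = contraction_mul (rep u) (rep v).
Proof.
have [_ fM _] := f_hom; have [_ gM _] := g_hom.
elim/tensor_ind: u => [|u u' IH IH'|a b].
- rewrite [X in rep X](linear_fun0 (@tensor_mul_linl _ _ A B _)) rep0.
  exact: contraction_eqP.
- rewrite [X in rep X](linear_funD (@tensor_mul_linl _ _ A B _)) !repD.
  by rewrite [X in X + _]IH [X in _ + X]IH'; exact: contraction_eqP.
have [lT _ _] := contractionP (rep (pure a b)).
elim/tensor_ind: v => [|v v' IH IH'|a' b'].
- rewrite [X in rep X](linear_fun0 (@tensor_mul_linr _ _ A B _)) rep0.
  by apply: contraction_eqP => xi; rewrite /= linear_op0.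
- rewrite [X in rep X](linear_funD (@tensor_mul_linr _ _ A B _)) !repD.
  rewrite [X in X + _]IH [X in _ + X]IH'.
  by apply: contraction_eqP => xi; rewrite /= linear_opD.
by rewrite [X in rep X]tensor_mul_pure !spatial_rep_pure fM gM op_tensorM.
Qed.

Lemma spatial_rep_adjoint (u : AB) : is_adjoint (rep u) (rep (sa_star u)).
Proof.
have starl : linear (fun v : AB => sa_star v) := @tensor_star_linear _ _ A B.
elim/tensor_ind: u => [|u u' IH IH'|a b].
- by rewrite (linear_fun0 starl) rep0; exact: is_adjoint0.
- by rewrite (linear_funD starl) !repD; exact: is_adjointD.
have -> : sa_star (pure a b : AB) = pure (sa_star a) (sa_star b) := tensor_star_pure a b.
by rewrite !spatial_rep_pure; apply: is_adjoint_op_tensor; exact: star_hom_is_adjoint.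
Qed.

Lemma spatial_rep_hom : star_hom rep.
Proof.
split; [exact: spatial_rep_linear|exact: spatial_repM|].
by move=> u; rewrite (is_adjoint_adjoint (spatial_rep_adjoint u)).
Qed.

(** The range of the representation is the algebra generated by the U (x) V. *)
Lemma range_spatial_rep : range rep = smallest (@subalgebra R p p_pr (X * Y)%type)
  [set op_tensor (f ab.1) (g ab.2) | ab in [set: A * B]].
Proof.
apply/seteqP; split=> [_ [u _ <-] S [[S0 SZD _] hS]|T].
  elim/tensor_ind: u => [|u u' IH IH'|a b]; first by rewrite rep0.
    by rewrite repD -[rep u]scale1r; exact: SZD.
  by rewrite spatial_rep_pure; apply: hS; exists (a, b).
apply; split=> [|_ [[a b] _ <-]]; last by exists (pure a b) => //; rewrite spatial_rep_pure.
split=> [|k _ _ [u _ <-] [v _ <-]|_ _ [u _ <-] [v _ <-]].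
- by exists 0 => //; rewrite rep0.
- by exists (k *: u + v) => //; rewrite spatial_rep_linear.
- by exists (sa_mul u v) => //; rewrite spatial_repM.
Qed.

End SpatialRepresentation.

(** * Completeness of the algebra of contractions *)

Section PadicLimits.
Variables (R : realType) (p : nat) (p_pr : prime p).
Local Notation Zp := (padic_int p_pr).
Local Notation Qp := (padic_num p_pr).
Local Notation frac := (@FracField.tofrac (padic_int p_pr)).
Local Notation integral := (@padic_integral _ p_pr).
Local Notation pabs := (padic_abs R).
Local Notation pR := (p%:R : R).

Lemma padic_residueB (x y : Zp) n : (x - y) n = 0%N <-> x n = y n.
Proof.
have lt (z : Zp) : (z n < p ^ n)%N.
  by rewrite -[z n]residue_mod ltn_mod expn_gt0 prime_gt0.
split=> [h|h].
  by rewrite -(subrK y x) padicDE h add0n residue_mod.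
by rewrite padicDE padicNE modnDmr h subnKC ?modnn// ltnW.
Qed.

(** The sequence a tends to l in Q_p. *)
Definition padic_lim (a : nat -> Qp) (l : Qp) :=
  forall e : R, 0 < e -> exists n, forall i, (n <= i)%N -> pabs (a i - l) < e.

Lemma padic_int_complete (z : nat -> Zp) :
  (forall e : R, 0 < e -> exists n, forall i j, (n <= i)%N -> (n <= j)%N ->
    padic_int_abs R (z i - z j) < e) ->
  exists l, forall e : R, 0 < e -> exists n, forall i, (n <= i)%N ->
    padic_int_abs R (z i - l) < e.
Proof.
move=> cz.
(* Each residue of z i is eventually constant in i. *)
have /choice[N hN] : forall k, exists n, forall i j,
    (n <= i)%N -> (n <= j)%N -> z i k = z j k.
  move=> k; have [n hn] := cz _ (prime_RX_gt0 R p_pr k); exists n => i j ni nj.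
  by apply/padic_residueB/eqP; rewrite -(padic_int_abs_le R) ltW// hn.
have hl : compatible p (fun k => z (N k) k).
  move=> m n mn; rewrite (hN n _ (maxn (N m) (N n)))// ?leq_maxr// residueP//.
  by apply: hN => //; exact: leq_maxl.
exists (padic_mk hl : Zp) => e /(exists_pX_lt p_pr)[k hk]; exists (N k) => i Ni.
apply: le_lt_trans hk; rewrite padic_int_abs_le; apply/eqP/padic_residueB => /=.
exact: hN.
Qed.

Lemma padic_complete (a : nat -> Qp) :
  (forall e : R, 0 < e -> exists n, forall i j, (n <= i)%N -> (n <= j)%N ->
    pabs (a i - a j) < e) -> exists l, padic_lim a l.
Proof.
move=> ca; have [N hN] := ca 1 ltr01.
have /choice[z hz] : forall i, exists z : Zp, a (N + i)%N - a N = frac z.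
  by move=> i; apply: (proj2 (@padic_absP R p p_pr _)); rewrite ltW// hN// leq_addr.
have zE i j : padic_int_abs R (z i - z j) = pabs (a (N + i)%N - a (N + j)%N).
  by rewrite -padic_abs_int tofracB -!hz opprB addrA subrK.
have [l hl] : exists l, forall e : R, 0 < e -> exists n, forall i, (n <= i)%N ->
    padic_int_abs R (z i - l) < e.
  apply: padic_int_complete => e /ca[n hn]; exists n => i j ni nj.
  by rewrite zE; apply: hn; [apply: leq_trans ni _|apply: leq_trans nj _]; exact: leq_addl.
(* From N on, the sequence differs from a N by p-adic integers, of limit l. *)
exists (a N + frac l) => e /hl[n hn]; exists (N + n)%N => i ni.
have /hn : (n <= i - N)%N by rewrite leq_subRL// (leq_trans _ ni)// leq_addr.
rewrite -padic_abs_int tofracB -hz subnKC; last by rewrite (leq_trans _ ni)// leq_addr.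
by rewrite opprD addrA.
Qed.

Lemma padic_lim_le (a : nat -> Qp) l b (e : R) N : 0 < e -> padic_lim a l ->
  (forall j, (N <= j)%N -> pabs (b - a j) <= e) -> pabs (b - l) <= e.
Proof.
move=> e0 /(_ e e0)[n hn] h; pose j := maxn N n.
rewrite -(subrK (a j) b) -addrA; apply: (le_trans (padic_absD _ _ _)).
by rewrite ge_max h ?leq_maxl// ltW// hn// leq_maxr.
Qed.

End PadicLimits.

Section Completeness.
Variables (R : realType) (p : nat) (p_pr : prime p) (X : pointedType).
Local Notation Zp := (padic_int p_pr).
Local Notation Qp := (padic_num p_pr).
Local Notation QpX := (padic_fun p_pr X).
Local Notation frac := (@FracField.tofrac (padic_int p_pr)).
Local Notation integral := (@padic_integral _ p_pr).
Local Notation pabs := (padic_abs R).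
Local Notation pR := (p%:R : R).
Local Notation B := (contraction R p_pr X).
Local Notation norm := (@contraction_norm R p p_pr X).
Implicit Types (xi eta : QpX) (S T : B).

(** The bound |T xi| <= |T| |xi|, with p ^ n as a bound of the possibly
    nonintegral xi. *)
Lemma contraction_ub T xi n x : (forall x, (p%:R ^+ n *: xi) x \in integral) ->
  pabs (T xi x) <= pR ^+ n * norm T.
Proof.
move=> /contraction_norm_ub h; have [lT _ _] := contractionP T.
have := h R T x; rewrite (linear_opZ lT) padic_funZ padic_absM padic_abs_pX.
by rewrite ler_pdivrMl ?exprn_gt0 ?prime_R_gt0.
Qed.

(** The operators T_ n tend to T in norm. *)
Definition contraction_lim (T_ : nat -> B) T :=
  forall e : R, 0 < e -> exists n, forall i, (n <= i)%N -> norm (T_ i - T) < e.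

Let linear_error (F : comPzRingType) (c a a' b b' d : F) :
  d - (c * a' + b') = (c * (a - a') + (b - b')) - ((c * a + b) - d).
Proof. by ring. Qed.

Lemma contraction_complete (T_ : nat -> B) :
  (forall e : R, 0 < e -> exists n, forall i j, (n <= i)%N -> (n <= j)%N ->
    norm (T_ i - T_ j) < e) -> exists T, contraction_lim T_ T.
Proof.
move=> cT.
have cauchy_uniform xi (e : R) : 0 < e -> exists n, forall i j, (n <= i)%N -> (n <= j)%N ->
    forall x, pabs (T_ i xi x - T_ j xi x) < e.
  move=> e0; have [m hm] := padic_fun_scale_integral R xi.
  have pm0 : 0 < pR ^+ m by rewrite exprn_gt0// prime_R_gt0.
  have [n hn] := cT _ (divr_gt0 e0 pm0); exists n => i j ni nj x.
  apply: (le_lt_trans (contraction_ub (T_ i - T_ j) x hm)).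
  by rewrite mulrC -ltr_pdivlMr// hn.
have lim_ex (q : QpX * X) : exists l, padic_lim R (fun i => T_ i q.1 q.2) l.
  apply: padic_complete => e /(cauchy_uniform q.1)[n hn]; exists n => i j ni nj.
  exact: hn.
have {lim_ex} [L_ hL] := choice lim_ex; pose L xi x := L_ (xi, x).
have {hL} hL xi x : padic_lim R (fun i => T_ i xi x) (L xi x) := hL (xi, x).
have approx xi (e : R) : 0 < e -> exists n, forall i, (n <= i)%N ->
    forall x, pabs (T_ i xi x - L xi x) <= e.
  move=> e0; have [n hn] := cauchy_uniform xi e e0; exists n => i ni x.
  by apply: (padic_lim_le (N := n) e0 (hL xi x)) => j nj; exact/ltW/hn.
have L_fun xi : L xi \in @almost_integral _ p_pr X.
  have [n hn] := approx xi 1 ltr01.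
  apply/asboolP/(sub_finite_set _ (padic_fun_fin (T_ n xi))) => x /=.
  apply: contra => hx; have /(padic_integralP R) h := hn n (leqnn n) x.
  by rewrite -[L xi x](subKr (T_ n xi x)); exact: rpredB.
(* T is the pointwise limit of the T_ n. *)
pose T xi := PadicFun (L_fun xi).
have lT : linear T.
  move=> k xi eta; apply: padic_funP => x; apply/eqP; rewrite -subr_eq0.
  rewrite -(padic_abs_eq0 R) eq_le padic_abs_ge0 andbT.
  apply/ler_addgt0Pr => e e0; rewrite add0r.
  have [n1 h1] := approx xi e e0; have [n2 h2] := approx eta e e0.
  have [n3 h3] := approx (k *: xi + eta) e e0; pose n := maxn n1 (maxn n2 n3).
  have /h1/(_ x) {}h1 : (n1 <= n)%N by rewrite leq_maxl.
  have /h2/(_ x) {}h2 : (n2 <= n)%N by rewrite !leq_max leqnn orbT.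
  have /h3/(_ x) {}h3 : (n3 <= n)%N by rewrite !leq_max leqnn !orbT.
  have [lTn _ _] := contractionP (T_ n).
  have -> : T (k *: xi + eta) x - (k *: T xi + T eta) x =
      (frac k * (T_ n xi x - L xi x) + (T_ n eta x - L eta x)) -
      (T_ n (k *: xi + eta) x - L (k *: xi + eta) x).
    have -> : T_ n (k *: xi + eta) x = frac k * T_ n xi x + T_ n eta x by rewrite lTn.
    have -> : (k *: T xi + T eta) x = frac k * L xi x + L eta x by [].
    exact: linear_error.
  apply: (le_trans (padic_absB _ _ _)); rewrite ge_max h3 andbT.
  apply: (le_trans (padic_absD _ _ _)); rewrite ge_max h2 andbT.
  apply: le_trans h1; rewrite padic_absM padic_abs_int.
  by rewrite ler_piMl ?padic_abs_ge0// padic_int_abs_le1.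
have T1 : (op_norm R T <= 1)%E.
  apply/op_norm_le1 => xi hxi x; have [n hn] := approx xi 1 ltr01.
  have /(padic_integralP R) h := hn n (leqnn n) x.
  by rewrite -[T xi x](subKr (T_ n xi x)) rpredB// contraction_integral.
have unif (e : R) : 0 < e -> exists n, forall i, (n <= i)%N -> forall xi,
    (forall x, xi x \in integral) -> forall x, pabs (T_ i xi x - T xi x) <= e.
  move=> e0; have [n hn] := cT e e0; exists n => i ni xi hxi x.
  apply: (padic_lim_le (N := n) e0 (hL xi x)) => j nj.
  exact: (le_trans (contraction_norm_ub (T_ i - T_ j) x hxi) (ltW (hn _ _ ni nj))).
have hT : T \in @contractive_operator R p p_pr X.
  apply/asboolP; split=> //; apply/tau_continuousP => // F finF e e0.
  have e20 : 0 < e / 2 by rewrite divr_gt0.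
  have [n hn] := unif _ e20; have [lTn cTn Tn1] := contractionP (T_ n).
  have [G [finG [d [d0 h]]]] := (tau_continuousP lTn Tn1).1 cTn F finF e e0.
  exists G; split=> //; exists d; split=> // xi hxi hG x Fx.
  rewrite -[T xi x](subKr (T_ n xi x)); apply: (le_lt_trans (padic_absB _ _ _)).
  rewrite gt_max h//= (le_lt_trans (hn n _ _ hxi _))//.
  by rewrite ltr_pdivrMr// ltr_pMr// ltr1n.
exists (Contraction hT) => e e0; have e20 : 0 < e / 2 by rewrite divr_gt0.
have [n hn] := unif _ e20; exists n => i ni.
apply: (@le_lt_trans _ _ (e / 2)); last by rewrite ltr_pdivrMr// ltr_pMr// ltr1n.
by apply/contraction_norm_le => xi hxi x; rewrite contractionB padic_funB; exact: hn.
Qed.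

Lemma contraction_normB S T : norm (S - T) = norm (T - S).
Proof. by rewrite -contraction_normN opprB. Qed.

Lemma contraction_lim_unique (T_ : nat -> B) T S :
  contraction_lim T_ T -> contraction_lim T_ S -> T = S.
Proof.
move=> hT hS; apply/subr0_eq/contraction_norm_eq0/eqP.
rewrite eq_le contraction_norm_ge0 andbT; apply/ler_addgt0Pr => e e0; rewrite add0r.
have [n hn] := hT e e0; have [m hm] := hS e e0; pose i := maxn n m.
rewrite -(subrK (T_ i) T) -addrA; apply: (le_trans (contraction_normD _ _)).
rewrite ge_max contraction_normB; apply/andP; split; apply: ltW.
  by apply: hn; exact: leq_maxl.
by apply: hm; exact: leq_maxr.
Qed.

Lemma contraction_limZD k (T_ S_ : nat -> B) T S : contraction_lim T_ T ->
  contraction_lim S_ S -> contraction_lim (fun n => k *: T_ n + S_ n) (k *: T + S).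
Proof.
move=> hT hS e e0; have [n hn] := hT e e0; have [m hm] := hS e e0.
exists (maxn n m) => i; rewrite geq_max => /andP[ni mi].
have -> : k *: T_ i + S_ i - (k *: T + S) = k *: (T_ i - T) + (S_ i - S).
  by rewrite scalerBr opprD addrACA.
apply: (le_lt_trans (contraction_normD _ _)).
rewrite gt_max; apply/andP; split; last exact: hm.
apply: (le_lt_trans (contraction_normZ _ _)).
apply: le_lt_trans (hn i ni).
by rewrite ler_piMl ?contraction_norm_ge0// padic_int_abs_le1.
Qed.

Lemma contraction_limM (T_ S_ : nat -> B) T S : contraction_lim T_ T ->
  contraction_lim S_ S ->
  contraction_lim (fun n => contraction_mul (T_ n) (S_ n)) (contraction_mul T S).
Proof.
move=> hT hS e e0; have [n hn] := hT e e0; have [m hm] := hS e e0.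
exists (maxn n m) => i; rewrite geq_max => /andP[ni mi].
have -> : contraction_mul (T_ i) (S_ i) - contraction_mul T S =
    contraction_mul (T_ i) (S_ i - S) + contraction_mul (T_ i - T) S.
  apply: contraction_eqP => xi; have [lT _ _] := contractionP (T_ i).
  change (T_ i (S_ i xi) - T (S xi) =
    T_ i (S_ i xi - S xi) + (T_ i (S xi) - T (S xi))).
  by rewrite (linear_funB lT) addrA subrK.
apply: (le_lt_trans (contraction_normD _ _)); rewrite gt_max; apply/andP; split.
  apply: (le_lt_trans (contraction_normM _ _)); apply: le_lt_trans (hm i mi).
  by rewrite ler_piMl ?contraction_norm_ge0// contraction_norm_le1.
apply: (le_lt_trans (contraction_normM _ _)); apply: le_lt_trans (hn i ni).
by rewrite ler_piMr ?contraction_norm_ge0// contraction_norm_le1.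
Qed.

Lemma contraction_lim_adjoint (T_ S_ : nat -> B) T S : contraction_lim T_ T ->
  contraction_lim S_ S -> (forall n, is_adjoint (T_ n) (S_ n)) -> is_adjoint T S.
Proof.
move=> hT hS TS xi eta.
have [m hm] := padic_fun_scale_integral R xi; have [l hl] := padic_fun_scale_integral R eta.
have pml : 0 < pR ^- (m + l) by rewrite prime_RX_gt0.
have [n1 h1] := hT _ pml; have [n2 h2] := hS _ pml; pose n := maxn n1 n2.
(* If p ^ a xi' and p ^ b eta' are integral and |D| <= p ^ - (a + b) then
   D xi' and eta' pair to zero. *)
have small (D : B) (xi' eta' : QpX) a b : norm D <= pR ^- (a + b) ->
    (forall x, (p%:R ^+ a *: xi') x \in integral) ->
    (forall x, (p%:R ^+ b *: eta') x \in integral) -> pairing (D xi') eta' = 0.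
  move=> hD ha hb; apply: (pairing_integral _) => x; apply/(padic_integralP R).
  rewrite padic_absM; have /(padic_integralP R) := hb x.
  rewrite padic_funZ padic_absM padic_abs_pX ler_pdivrMl ?exprn_gt0 ?prime_R_gt0//.
  rewrite mulr1 => hbx; apply: le_trans (_ : pR ^- b * pR ^+ b <= 1); last first.
    by rewrite mulVf// gt_eqF// exprn_gt0// prime_R_gt0.
  rewrite ler_pM ?padic_abs_ge0//; apply: (le_trans (contraction_ub D x ha)).
  rewrite -ler_pdivlMl ?exprn_gt0 ?prime_R_gt0//; apply: (le_trans hD).
  by rewrite exprD invfM.
have e1 : pairing ((T_ n - T) xi) eta = 0.
  by apply: (small _ _ _ m l) => //; apply/ltW/h1; exact: leq_maxl.
have e2 : pairing ((S_ n - S) eta) xi = 0.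
  by apply: (small _ _ _ l m) => //; rewrite addnC; apply/ltW/h2; exact: leq_maxr.
have -> : T xi = T_ n xi - (T_ n - T) xi by rewrite contractionB subKr.
rewrite pairingDl pairingNl e1 oppr0 addr0 TS.
have -> : S_ n eta = (S_ n - S) eta + S eta by rewrite contractionB subrK.
by rewrite pairingDr [pairing xi _]pairingC e2 add0r.
Qed.

Lemma contraction_lim_norm (T_ : nat -> B) T : contraction_lim T_ T ->
  norm (T_ n) @[n --> \oo] --> norm T.
Proof.
move=> hT; apply/cvgrPdist_lt => e /hT[n hn]; exists n => // i /= ni.
apply: le_lt_trans (hn i ni).
have h U V : norm U <= norm V + norm (U - V).
  rewrite -{1}(subrK V U); apply: (le_trans (contraction_normD _ _)).
  by rewrite ge_max lerDr lerDl !contraction_norm_ge0.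
rewrite ler_norml; apply/andP; split.
  by rewrite lerNl opprB lerBlDl h.
by rewrite lerBlDl contraction_normB h.
Qed.

End Completeness.

(** * Extension of a representation to the completion *)

Section Extension.
Variables (R : realType) (p : nat) (p_pr : prime p) (X : pointedType).
Variables (C : seminormed_algebra p_pr R) (f : C -> contraction R p_pr X).
Local Notation B := (contraction R p_pr X).
Hypothesis f_isom : isometric_star_hom f.

Let fB : {morph f : x y / x - y}.
Proof. by have [[lf _ _] _] := f_isom; exact: linear_funB. Qed.

Let f_norm c : contraction_norm (f c) = sna_norm c.
Proof. by have [_ ->] := f_isom. Qed.

(** The continuous extension of f to the completion of C; the limit exists
    because f is isometric, so the default value 0 is not taken. *)
Definition completion_ext (u : completion C) : B :=
  xget 0 [set T | contraction_lim (fun n => f (comp_repr u n)) T].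

Lemma completion_extP (x : cauchy C) :
  contraction_lim (fun n => f (x n)) (completion_ext (comp_class x)).
Proof.
have [T hT] : exists T, contraction_lim (fun n => f (x n)) T.
  apply: contraction_complete => e /(cauchyP x)[n hn]; exists n => i j ni nj.
  by rewrite -fB f_norm hn.
suff hT' : contraction_lim (fun n => f (comp_repr (comp_class x) n)) T.
  have hS := xgetI 0 (hT' :
    [set S | contraction_lim (fun n => f (comp_repr (comp_class x) n)) S] T).
  by rewrite /completion_ext (contraction_lim_unique hS hT').
move=> e e0; have [n hn] := hT e e0.
have /asboolP/(_ e e0)[m hm] := comp_reprP x.
exists (maxn n m) => i; rewrite geq_max => /andP[ni mi].
rewrite -(subrK (f (x i)) (f _)) -addrA; apply: (le_lt_trans (contraction_normD _ _)).
rewrite gt_max; apply/andP; split; last exact: hn.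
by rewrite -fB f_norm; exact: hm.
Qed.

Lemma completion_ext_unique (x : cauchy C) T :
  contraction_lim (fun n => f (x n)) T -> completion_ext (comp_class x) = T.
Proof. by apply: contraction_lim_unique; exact: completion_extP. Qed.

Lemma completion_ext_isom : isometric_star_hom completion_ext.
Proof.
have [f_hom _] := f_isom; have [lf fM fs] := f_hom.
split; first split.
- move=> k u v; rewrite -[u]comp_reprK -[v]comp_reprK -comp_classZD.
  apply: completion_ext_unique.
  rewrite (_ : (fun n => _) = fun n => k *: f (comp_repr u n) + f (comp_repr v n)).
    by apply: contraction_limZD; exact: completion_extP.
  by apply/funext => n; exact: lf.
- move=> u v; rewrite -[u]comp_reprK -[v]comp_reprK [sa_mul _ _]comp_mulE.
  apply: completion_ext_unique.
  rewrite (_ : (fun n => _) =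
    fun n => contraction_mul (f (comp_repr u n)) (f (comp_repr v n))).
    by apply: contraction_limM; exact: completion_extP.
  by apply/funext => n; exact: fM.
- move=> u; rewrite -[u]comp_reprK [sa_star _]comp_starE.
  apply/esym/is_adjoint_adjoint.
  apply: (contraction_lim_adjoint (completion_extP _) (completion_extP _)) => n.
  exact: star_hom_is_adjoint.
- move=> u; rewrite -[u]comp_reprK.
  have h1 := contraction_lim_norm (completion_extP (comp_repr u)).
  have h2 := @comp_normE _ _ _ C (comp_repr u).
  have e : (fun n => contraction_norm (f (comp_repr u n))) =
    fun n => sna_norm (comp_repr u n).
    by apply/funext => n; exact: f_norm.
  by rewrite e in h1; exact: (cvg_unique _ h1 h2).
Qed.

Lemma range_completion_ext : range completion_ext = norm_closure (range f).
Proof.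
apply/seteqP; split=> [_ [u _ <-] e e0|T hT].
  have := completion_extP (comp_repr u); rewrite comp_reprK => /(_ e e0)[n hn].
  exists (f (comp_repr u n)); first by exists (comp_repr u n).
  by rewrite contraction_normB hn.
have /choice[c hc] n : exists c, contraction_norm (T - f c) < n.+1%:R^-1.
  have [|_ [c _ <-] hc] := hT n.+1%:R^-1; first by rewrite invr_gt0 ltr0n.
  by exists c.
have lim_f : contraction_lim (fun n => f (c n)) T.
  move=> e e0; exists (Num.bound e^-1) => i ni; rewrite contraction_normB.
  apply: (lt_trans (hc i)); rewrite invf_plt ?posrE ?ltr0n//.
  apply: (lt_trans (archi_boundP _)); first by rewrite invr_ge0 ltW.
  by rewrite ltr_nat ltnS.
have cc : c \in @cauchy_seq _ p_pr _ C.
  apply/asboolP => e /lim_f[n hn]; exists n => i j ni nj; rewrite -f_norm fB.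
  rewrite -(subrK T (f (c i))) -addrA; apply: (le_lt_trans (contraction_normD _ _)).
  rewrite gt_max; apply/andP; split; first exact: hn.
  by rewrite contraction_normB; exact: hn.
exists (comp_class (Cauchy cc)) => //; exact: completion_ext_unique.
Qed.

End Extension.

(** * Comparison of the three norms *)

Section NormComparison.
Variables (R : realType) (p : nat) (p_pr : prime p).

Lemma u_norm_le1 (C : star_algebra p_pr) (c : C) : u_norm R c <= 1.
Proof.
rewrite /u_norm; set S := [set _ | _].
have [->|/set0P S0] := eqVneq S set0; first by rewrite sup0 ler01.
by apply: ge_sup => // _ [Z [s [_ ->]]]; exact: contraction_norm_le1.
Qed.

Lemma le_u_norm (C : star_algebra p_pr) (Z : pointedType)
  (s : C -> contraction R p_pr Z) c : star_hom s -> contraction_norm (s c) <= u_norm R c.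
Proof.
move=> hs; apply: ub_le_sup; last by exists Z, s.
by exists 1 => _ [Z' [s' [_ ->]]]; exact: contraction_norm_le1.
Qed.

(** A seminormed algebra is determined by its underlying algebra and its
    seminorm. *)
Lemma seminormed_algebra_eq (C : star_algebra p_pr) (N N' : C -> R)
    (hN : star_seminorm N) (hN' : star_seminorm N') :
  N = N' -> SeminormedAlgebra hN = SeminormedAlgebra hN'.
Proof. by move=> NN'; subst N'; rewrite (Prop_irrelevance hN hN'). Qed.

Variables (A B : seminormed_algebra p_pr R).
Hypotheses (A_can : is_canonical_norm (@sna_norm _ _ _ A))
  (B_can : is_canonical_norm (@sna_norm _ _ _ B)).
Local Notation AB := (tensor_algebra A B).

Lemma proj_norm_le1 (u : AB) : proj_norm u <= 1.
Proof.
apply: (@le_trans _ _ (proj_cost (repr u))).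
  apply: ge_inf; last by exists (repr u) => //=; exact: tensor_sum.
  by exists 0 => _ [s _ <-]; exact: bigmax_ge_id.
rewrite /proj_cost; apply: bigmax_le => // ab _; rewrite -[leRHS]mulr1.
by rewrite ler_pM ?(sn_ge0 (sna_seminorm _))// canonical_norm_le1.
Qed.

(** A canonical norm N on the tensor product satisfies N (a (x) b) <= |a| |b|, as
    (p ^ n a) (x) (p ^ m b) is divisible by p ^ (n + m). *)
Lemma canonical_norm_pure (N : AB -> R) (a : A) (b : B) :
  is_canonical_norm N -> N (pure a b) <= sna_norm a * sna_norm b.
Proof.
move=> hN.
have [->|/(canonical_normP A_can)[n [a' [-> -> _]]]] := eqVneq a 0.
  rewrite (linear_fun0 (@pure_linl _ A B b)) (canonical_norm0 hN).
  by rewrite (canonical_norm0 A_can) mul0r.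
have [->|/(canonical_normP B_can)[m [b' [-> -> _]]]] := eqVneq b 0.
  rewrite (linear_fun0 (@pure_linr _ A B _)) (canonical_norm0 hN).
  by rewrite (canonical_norm0 B_can) mulr0.
rewrite pureZ (linear_funZ (@pure_linl _ A B b')) scalerA -exprD addnC.
by rewrite -invfM -exprD; exact: canonical_norm_pX.
Qed.

Lemma canonical_le_proj_norm (N : AB -> R) : is_canonical_norm N ->
  (forall u v, N (u + v) <= Num.max (N u) (N v)) -> forall u, N u <= proj_norm u.
Proof.
move=> hN ND u; apply: lb_le_inf.
  by exists (proj_cost (repr u)), (repr u) => //=; exact: tensor_sum.
move=> _ [s /= -> <-]; rewrite /proj_cost.
elim: s => [|ab s IH]; first by rewrite !big_nil (canonical_norm0 hN).
rewrite !big_cons; apply: (le_trans (ND _ _)).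
by rewrite ge_max !le_max IH orbT canonical_norm_pure.
Qed.

End NormComparison.

Theorem theorem1p3 (R : realType) (p : nat) (p_pr : prime p)
  (X Y : pointedType) (A B : padic_operator_algebra R p_pr)
  (iA : A -> contraction R p_pr X) (iB : B -> contraction R p_pr Y)
  (iA_emb : isometric_star_hom iA) (iB_emb : isometric_star_hom iB)
  (A_can : is_canonical_norm (@sna_norm _ _ _ A))
  (B_can : is_canonical_norm (@sna_norm _ _ _ B))
  (AB_can : is_canonical_norm
     (fun u : tensor_algebra A B => contraction_norm (spatial_rep iA iB u))) :
  (exists f : max_tensor R A B -> proj_tensor A B, star_isometry f) /\
  (exists g : proj_tensor A B -> contraction R p_pr (X * Y)%type,
     isometric_star_hom g /\ range g = min_tensor iA iB).
Proof.
pose N (u : tensor_algebra A B) := contraction_norm (spatial_rep iA iB u).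
have [iA_hom _] := iA_emb; have [iB_hom _] := iB_emb.
have rep_hom := spatial_rep_hom iA_hom iB_hom.
have ND u v : N (u + v) <= Num.max (N u) (N v).
  by rewrite /N (linear_funD (spatial_rep_linear iA_hom iB_hom)); exact: contraction_normD.
have projE : @proj_norm R p p_pr A B = N.
  apply/funext => u; apply/eqP; rewrite eq_le.
  rewrite (canonical_le_proj_norm A_can B_can AB_can ND) andbT.
  apply: (le_canonical_norm AB_can) => [k v|v].
    exact: (sn_scale (proj_seminorm A B)).
  exact: proj_norm_le1.
have uE : @u_norm R p p_pr (tensor_algebra A B) = N.
  apply/funext => u; apply/eqP; rewrite eq_le (le_u_norm u rep_hom) andbT.
  apply: (le_canonical_norm AB_can) => [k v|v].
    exact: (sn_scale (u_seminorm R (tensor_algebra A B))).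
  exact: u_norm_le1.
split.
  have -> : max_tensor R A B = proj_tensor A B.
    rewrite /max_tensor /enveloping_algebra /proj_tensor; congr completion.
    by apply: seminormed_algebra_eq; rewrite uE projE.
  by exists id; split=> //; exists id.
have rep_isom : @isometric_star_hom R p p_pr (SeminormedAlgebra (proj_seminorm A B))
    (X * Y)%type (spatial_rep iA iB).
  by split=> // u; rewrite /= projE.
exists (completion_ext (C := SeminormedAlgebra (proj_seminorm A B)) (spatial_rep iA iB)).
split; first exact: completion_ext_isom.
by rewrite (range_completion_ext rep_isom) /min_tensor (range_spatial_rep iA_hom iB_hom).
Qed.
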